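(* Let $\Omega\subset\mathbb R^d$ be open and $\omega\in\mathcal W$. Then $$\mathcal E^{\{\omega\}}_M(\Omega)=\tilde{\mathcal E}^{\{\omega\}}_M(\Omega)\qquad\text{and}\qquad \mathcal N^{\{\omega\}}(\Omega)=\tilde{\mathcal N}^{\{\omega\}}(\Omega).$$
   Context: $\mathbb R^+=[0,\infty)$. $\mathcal W$ is the set of all nondecreasing continuous functions $\omega:\mathbb R^+\to\mathbb R^+$ such that $\omega(0)=0$; $\omega(x+y)\le\omega(x)+\omega(y)$ for all $x,y\ge 0$; $\int_1^\infty \frac{\omega(t)}{t^2}\,dt<\infty$; and $\lim_{t\to\infty}\frac{\omega(t)}{\log(1+t)}=\infty$. For $\omega_1,\omega_2\in\mathcal W$, $\omega_1\ll\omega_2$ means $\omega_1(t)=o(\omega_2(t))$ as $t\to\infty$. For a compactly supported continuous $f$ on $\mathbb R^d$, $\sigma\in\mathcal W$, $l>0$: $\|f\|_l^{\sigma}=\int|\hat f(\xi)|e^{l\sigma(|\xi|)}d\xi\in[0,\infty]$. $\mathcal D^{\{\omega\}}(\Omega)$ is the set of continuous $f$ with compact support in $\Omega$ and $\|f\|_l^\omega<\infty$ for some $l>0$. $\mathcal E^{\{\omega\}}(\Omega)$ is the set of smooth $f:\Omega\to\mathbb C$ such that $\psi f\in\mathcal D^{\{\omega\}}(\Omega)$ for all $\psi\in\mathcal D^{\{\omega\}}(\Omega)$. For compact $K\subset\Omega$, $\|f\|_{K,l}^{\sigma}=\inf\{\|\psi f\|_l^{\sigma}:\psi\in\mathcal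 D^{\{\omega\}}(\Omega),\ \psi=1\text{ on }K\}$. All nets $(g_\varepsilon)$ below are in $\mathcal E^{\{\omega\}}(\Omega)^{(0,1)}$, $K$ ranges over compact subsets of $\Omega$, $\omega_1,\omega_2$ over $\mathcal W$, and $o(\cdot)$ is as $\varepsilon\to0^+$. - $(g_\varepsilon)\in\mathcal E^{\{\omega\}}_M(\Omega)$ iff $\forall K\ \forall k>0\ \exists h>0:\ \|g_\varepsilon\|_{K,h}^\omega=o(e^{k\omega(1/\varepsilon)})$. - $(g_\varepsilon)\in\mathcal N^{\{\omega\}}(\Omega)$ iff $\forall K\ \exists k>0\ \exists h>0:\ \|g_\varepsilon\|_{K,h}^\omega=o(e^{-k\omega(1/\varepsilon)})$. - $(g_\varepsilon)\in\tilde{\mathcal E}^{\{\omega\}}_M(\Omega)$ iff $\forall \omega_1\ll\omega\ \forall K\ \exists\omega_2\ll\omega:\ \|g_\varepsilon\|_{K,1}^{\omega_1}=o(e^{\omega_2(1/\varepsilon)})$. - $(g_\varepsilon)\in\tilde{\mathcal N}^{\{\omega\}}(\Omega)$ iff $\forall K\ \forall\omega_1\ll\omega\ \forall\omega_2\ll\omega:\ \|g_\varepsilon\|_{K,1}^{\omega_1}=o(e^{-\omega_2(1/\varepsilon)})$. *)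

(* Defs.v *)
From HB Require Import structures.
From mathcomp Require Import all_boot all_order all_algebra.
From mathcomp.real_closed Require Import complex.
From mathcomp Require Import all_classical all_reals all_analysis.

Set Implicit Arguments.
Unset Strict Implicit.
Unset Printing Implicit Defensive.

Import Order.TTheory GRing.Theory Num.Theory.
Import numFieldNormedType.Exports.

Local Open Scope classical_set_scope.
Local Open Scope ring_scope.

Section cons_measure.
Local Open Scope ereal_scope.
Context {dT : measure_display} {T : measurableType dT} {R : realType}.
Variables (n : nat) (m1 : {sigma_finite_measure set T -> \bar R})
  (m2 : {sigma_finite_measure set (n.-tuple T) -> \bar R}).

Definition tuple_cons (p : T * n.-tuple T) : n.+1.-tuple T :=
  [tuple of p.1 :: p.2].

Lemma measurable_tuple_cons : measurable_fun [set: T * n.-tuple T] tuple_cons.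
Proof. exact: measurable_cons. Qed.

Definition cons_measure : set (n.+1.-tuple T) -> \bar R :=
  pushforward (m1 \x m2) tuple_cons.

Let cons_measure0 : cons_measure set0 = 0.
Proof. by rewrite /cons_measure /pushforward preimage_set0 measure0. Qed.

Let cons_measure_ge0 A : 0 <= cons_measure A.
Proof. by rewrite /cons_measure /pushforward; exact: measure_ge0. Qed.

Let cons_measure_sigma_additive : semi_sigma_additive cons_measure.
Proof.
move=> F mF tF mUF; rewrite /cons_measure /pushforward preimage_bigcup.
apply: measure_semi_sigma_additive.
- by move=> k; rewrite -[X in measurable X]setTI; exact: measurable_tuple_cons.
- apply/trivIsetP => /= i j _ _ ij; rewrite -preimage_setI.
  by move/trivIsetP : tF => /(_ _ _ _ _ ij) ->//; rewrite preimage_set0.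
- rewrite -preimage_bigcup -[X in measurable X]setTI.
  exact: measurable_tuple_cons.
Qed.

HB.instance Definition _ := isMeasure.Build _ _ _ cons_measure
  cons_measure0 cons_measure_ge0 cons_measure_sigma_additive.

(* the library's own instance for products of sigma-finite measures is shadowed
   by the one for subprobabilities and is not inferred here *)
Let cons_measure_sigma_finite : sigma_finite setT cons_measure.
Proof.
have /sigma_finiteP[F [TF ndF Foo]] := sigma_finiteT m1.
have /sigma_finiteP[G [TG ndG Goo]] := sigma_finiteT m2.
pose uncons (t : n.+1.-tuple T) : T * n.-tuple T :=
  (thead t, [tuple of behead t]).
have consK : cancel tuple_cons uncons.
  by move=> [x t]; rewrite /uncons theadE; congr pair; apply/val_inj.
have muncons : measurable_fun [set: n.+1.-tuple T] uncons.
  apply/measurable_fun_pair; last exact: measurable_behead.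
  exact: (measurable_tnth ord0).
exists (fun k => uncons @^-1` (F k `*` G k)) => [|k].
  rewrite -preimage_bigcup; apply/esym/seteqP; split => // t _ /=.
  have [i _ Fi] : (\bigcup_k F k) (thead t) by rewrite -TF.
  have [j _ Gj] : (\bigcup_k G k) [tuple of behead t] by rewrite -TG.
  exists (maxn i j) => //; split.
  - by move: Fi; exact/subsetPset/ndF/leq_maxl.
  - by move: Gj; exact/subsetPset/ndG/leq_maxr.
have [mF finF] := Foo k; have [mG finG] := Goo k; split.
  by rewrite -[X in measurable X]setTI; apply: muncons => //; exact: measurableX.
rewrite /cons_measure /pushforward -comp_preimage.
rewrite (_ : uncons \o tuple_cons = id); last by apply/funext => p; exact: consK.
by rewrite preimage_id product_measure1E// lte_mul_pinfty// ge0_fin_numE.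
Qed.

HB.instance Definition _ := Measure_isSigmaFinite.Build _ _ _ cons_measure
  cons_measure_sigma_finite.

End cons_measure.

Fixpoint lebesgue_tuple (R : realType) (d : nat) :
    {sigma_finite_measure set (d.-tuple (measurableTypeR R)) -> \bar R} :=
  if d is d'.+1 then
    cons_measure (@lebesgue_measure R) (lebesgue_tuple R d')
  else \d_([tuple]).

Section weights.
Context {R : realType}.
Implicit Types w : R -> R.

(* A function on [0, +oo[ is represented by a total function on R whose values
   at negative numbers are irrelevant. *)
Definition weight : set (R -> R) := [set w : R -> R |
  [/\ (forall t : R, 0 <= t -> 0 <= w t),
      (forall s t : R, 0 <= s -> s <= t -> w s <= w t),
      {within `[0, +oo[, continuous w} &
      w 0 = 0] /\
  [/\ (forall s t : R, 0 <= s -> 0 <= t -> w (s + t) <= w s + w t),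
      (\int[@lebesgue_measure R]_(t in `[1%R, +oo[) (w t / t ^+ 2)%:E < +oo)%E &
      w t / ln (1 + t) @[t --> +oo] --> +oo]].

(* The unfolded form of the little-o of the library, whose notation needs a
   canonical filter structure that +oo lacks. *)
Definition dominated w1 w2 : Prop :=
  forall c : R, 0 < c -> \forall t \near +oo, `|w1 t| <= c * `|w2 t|.

(* F(e) = o(G(e)) as e -> 0+, for an F that may take the value +oo *)
Definition ereal_littleo0 (F : R -> \bar R) (G : R -> R) : Prop :=
  forall c : R, 0 < c -> \forall e \near 0^'+, (F e <= (c * G e)%:E)%E.

End weights.

Notation "w1 '<<_oo' w2" := (dominated w1 w2) (at level 70).

Section euclidean_space.
Context {R : realType} {d : nat}.
Implicit Types (u : 'rV[R]_d -> R) (f : 'rV[R]_d -> R[i]) (x xi : 'rV[R]_d)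
  (A Omega K : set 'rV[R]_d).

Definition vec (t : d.-tuple (measurableTypeR R)) : 'rV[R]_d :=
  \row_i tnth t i.

Definition eint (F : 'rV[R]_d -> \bar R) : \bar R :=
  (\int[lebesgue_tuple R d]_t F (vec t))%E.

Definition rint u : R := \int[lebesgue_tuple R d]_t u (vec t).

Definition cint f : R[i] :=
  Complex (rint (fun x => complex.Re (f x))) (rint (fun x => complex.Im (f x))).

Definition dot x xi : R := \sum_(i < d) x 0 i * xi 0 i.

(* the norm of 'rV[R]_d in the library is the maximum norm *)
Definition enorm xi : R := Num.sqrt (dot xi xi).

Definition expi (t : R) : R[i] := Complex (cos t) (sin t).

Definition fourier f xi : R[i] := cint (fun x => f x * expi (- dot x xi)).

(* R[i] is not a normed module over R in the library: continuity and
   smoothness are stated for the real and imaginary parts. *)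
Definition ccontinuous f : Prop :=
  continuous (fun x => complex.Re (f x)) /\
  continuous (fun x => complex.Im (f x)).

Definition partial (i : 'I_d) u : 'rV[R]_d -> R :=
  fun x => 'D_(delta_mx 0 i) u x.

Definition smooth_on A u : Prop := forall s : seq 'I_d,
  let v := foldr partial u s in forall x, A x ->
  {for x, continuous v} /\ forall i : 'I_d, derivable v x (delta_mx 0 i).

Definition csmooth_on A f : Prop :=
  smooth_on A (fun x => complex.Re (f x)) /\
  smooth_on A (fun x => complex.Im (f x)).

Definition supp f : set 'rV[R]_d := closure [set x | f x != 0].

Definition wnorm (sigma : R -> R) (l : R) f : \bar R :=
  eint (fun xi => (ComplexField.Normc.normc (fourier f xi) *
                   expR (l * sigma (enorm xi)))%:E).

Definition spaceD (w : R -> R) Omega : set ('rV[R]_d -> R[i]) := [set f |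
  [/\ ccontinuous f, compact (supp f), supp f `<=` Omega &
      exists2 l : R, 0 < l & (wnorm w l f < +oo)%E]].

(* A function on Omega is represented by a total function whose values outside
   Omega are irrelevant: for psi in spaceD w Omega, psi * f vanishes there. *)
Definition spaceE (w : R -> R) Omega : set ('rV[R]_d -> R[i]) := [set f |
  csmooth_on Omega f /\
  forall psi, spaceD w Omega psi -> spaceD w Omega (psi \* f)].

Definition wnormK (w : R -> R) Omega (sigma : R -> R) K (l : R) f : \bar R :=
  ereal_inf [set wnorm sigma l (psi \* f) | psi in
    [set psi | spaceD w Omega psi /\ forall x, K x -> psi x = 1]].

End euclidean_space.

Section nets.
Context {R : realType} {d : nat}.
Variables (w : R -> R) (Omega : set 'rV[R]_d).
Implicit Types (g : R -> 'rV[R]_d -> R[i]) (K : set 'rV[R]_d).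

Definition compact_in K : Prop := compact K /\ K `<=` Omega.

(* nets indexed by ]0, 1[; the values at other indices are irrelevant *)
Definition netE : set (R -> 'rV[R]_d -> R[i]) :=
  [set g | forall e, 0 < e < 1 -> spaceE w Omega (g e)].

Definition moderate_nets : set (R -> 'rV[R]_d -> R[i]) := [set g | netE g /\
  forall K, compact_in K -> forall k : R, 0 < k -> exists2 h : R, 0 < h &
    ereal_littleo0 (fun e => wnormK w Omega w K h (g e))
                   (fun e => expR (k * w e^-1))].

Definition negligible_nets : set (R -> 'rV[R]_d -> R[i]) := [set g | netE g /\
  forall K, compact_in K -> exists2 k : R, 0 < k & exists2 h : R, 0 < h &
    ereal_littleo0 (fun e => wnormK w Omega w K h (g e))
                   (fun e => expR (- k * w e^-1))].

Definition moderate_nets_tilde : set (R -> 'rV[R]_d -> R[i]) := [set g | netE g /\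
  forall w1, weight w1 -> w1 <<_oo w -> forall K, compact_in K ->
  exists w2, [/\ weight w2, w2 <<_oo w &
    ereal_littleo0 (fun e => wnormK w Omega w1 K 1 (g e))
                   (fun e => expR (w2 e^-1))]].

Definition negligible_nets_tilde : set (R -> 'rV[R]_d -> R[i]) := [set g | netE g /\
  forall K, compact_in K -> forall w1, weight w1 -> w1 <<_oo w ->
  forall w2, weight w2 -> w2 <<_oo w ->
    ereal_littleo0 (fun e => wnormK w Omega w1 K 1 (g e))
                   (fun e => expR (- w2 e^-1))].

End nets.

(* Main.v *)
Require Import Defs.
From mathcomp Require Import all_boot all_order all_algebra.
From mathcomp.real_closed Require Import complex.
From mathcomp Require Import all_classical all_reals all_analysis.
From mathcomp Require Import measurable_realfun ring lra.

Set Implicit Arguments.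
Unset Strict Implicit.
Unset Printing Implicit Defensive.

Import Order.TTheory GRing.Theory Num.Theory.
Import numFieldNormedType.Exports.

Local Open Scope classical_set_scope.
Local Open Scope ring_scope.

Local Notation Re := (@complex.Re _).
Local Notation Im := (@complex.Im _).
Local Notation normc := (@ComplexField.Normc.normc _).

(** The inclusions that weaken a condition are elementary. If w1 << w, then
    w1 <= h w + C on [0, +oo[ for every h > 0, so that a bound on the norm of
    weight w and order h is also a bound on the norm of weight w1 and order 1.
    This settles negligible nets in one direction. For a moderate net it
    shows that the norms grow more slowly than expR (k * w (1 / e)) for every
    k > 0, and a weight w2 << w that absorbs this growth is needed.

    It is provided by exists_weight_between: every psi << w satisfies
    psi << w2 << w for some weight w2. One takes w2 = F o w with F the lower
    envelope of the lines x / (n + 1) + C n, where C 0 = 0 and C n grows fast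
    enough. Such an F is concave and vanishes at 0, so that F o w inherits
    from w every axiom of a weight but the growth condition, which is secured
    by adding ln (1 + t) to psi; and F o w << w because F x = o(x).

    The two other inclusions go by contradiction. If the net violates the
    condition for K, for all orders 1 / (n + 1), there are eps n -> 0 at which
    the norm of order 1 / (n + 1) is too large. Fix a cut-off chi equal to 1
    on K. The integral that defines the norm of chi * g (eps n) is already too
    large on a ball of radius r n. A weight w1 << w that exceeds
    w / (n + 1) on [S, max (r n) (1 / eps n)] for every n
    (exists_weight_steps, a case of exists_weight_between) then makes
    the w1-norms of chi * g (eps n) too large as well. In the negligible case
    the same w1 serves as the second weight.

    It remains to pass from the fixed chi to the infimum over all cut-offs
    psi equal to 1 on the support of chi (cutoff_wnorm_le). Since
    chi * g = chi * (psi * g), this follows from the submultiplicativity of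
    the norms (wnorm_mul_le), with a constant that depends only on chi and w1.
    Submultiplicativity comes from the subadditivity of the weight and
    from the fact that the Fourier transform of a product is a convolution
    (fourier_mul), hence from Fourier inversion (fourier_inversion).
    Inversion is proved by regularizing with exp (- |x 1| - ... - |x d|), whose
    Fourier transform is a product of Poisson kernels.

    This takes for granted that every compact subset of the open set has a
    cut-off. Otherwise some compact K has none; every norm attached to K is
    then an infimum over the empty set, that is +oo, and all four sets of
    nets are empty (no_cutoff_littleo0). *)

(** * Complex-valued integrals *)

Section complex_modulus.
Variable R : realType.
Implicit Types z : R[i].

Lemma complex_ReM z1 z2 : Re (z1 * z2) = Re z1 * Re z2 - Im z1 * Im z2.
Proof. by case: z1; case: z2. Qed.

Lemma complex_ImM z1 z2 : Im (z1 * z2) = Re z1 * Im z2 + Im z1 * Re z2.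
Proof. by case: z1; case: z2. Qed.

Lemma complexP z1 z2 : Re z1 = Re z2 -> Im z1 = Im z2 -> z1 = z2.
Proof. by case: z1 z2 => [a b] [c e] /= -> ->. Qed.

Lemma normc_ge0 z : 0 <= normc z.
Proof. by case: z => a b; exact: sqrtr_ge0. Qed.

Lemma normc_sqrt z : normc z = Num.sqrt (Re z ^+ 2 + Im z ^+ 2).
Proof. by case: z. Qed.

Lemma Re_le_normc z : `|Re z| <= normc z.
Proof. by rewrite normc_sqrt -sqrtr_sqr ler_wsqrtr// lerDl sqr_ge0. Qed.

Lemma Im_le_normc z : `|Im z| <= normc z.
Proof. by rewrite normc_sqrt -sqrtr_sqr ler_wsqrtr// lerDr sqr_ge0. Qed.

Lemma normc_le z : normc z <= `|Re z| + `|Im z|.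
Proof.
rewrite normc_sqrt -[leRHS]ger0_norm ?addr_ge0// -sqrtr_sqr ler_wsqrtr//.
by rewrite sqrrD !real_normK ?num_real// -addrA lerD2l lerDr mulrn_wge0 ?mulr_ge0.
Qed.

Lemma normc_expi t : normc (expi t : R[i]) = 1.
Proof. by rewrite normc_sqrt/= cos2Dsin2 sqrtr1. Qed.

Lemma expiD s t : expi (s + t) = expi s * expi t :> R[i].
Proof. by apply: complexP; rewrite ?complex_ReM ?complex_ImM/= ?cosD ?sinD 1?addrC// addrC mulrC. Qed.

Lemma expi0 : expi 0 = 1 :> R[i].
Proof. by rewrite /expi cos0 sin0. Qed.

End complex_modulus.

Section complex_integral.
Context {dT : measure_display} {T : measurableType dT} {R : realType}.
Variable mu : {measure set T -> \bar R}.
Implicit Types (f g : T -> R[i]) (u : T -> R).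

Lemma integrableZl_EFin (k : R) u :
  mu.-integrable setT (EFin \o u) -> mu.-integrable setT (EFin \o (fun x => k * u x)).
Proof.
move=> ui; apply: eq_integrable (integrableZl measurableT k ui) => //.
Qed.

Definition cmeasurable f :=
  measurable_fun setT (Re \o f) /\ measurable_fun setT (Im \o f).

Definition cintegrable f :=
  mu.-integrable setT (EFin \o (Re \o f)) /\
  mu.-integrable setT (EFin \o (Im \o f)).

Definition cintegral f : R[i] :=
  Complex (\int[mu]_x Re (f x)) (\int[mu]_x Im (f x)).

Lemma cmeasurableM f g :
  cmeasurable f -> cmeasurable g -> cmeasurable (fun x => f x * g x).
Proof.
move=> [mf1 mf2] [mg1 mg2]; split.
- under [X in measurable_fun _ X]funext => x do rewrite /= complex_ReM.
  by apply: measurable_funB; exact: measurable_funM.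
- under [X in measurable_fun _ X]funext => x do rewrite /= complex_ImM.
  by apply: measurable_funD; exact: measurable_funM.
Qed.

Lemma cmeasurable_cst (z : R[i]) : cmeasurable (fun=> z).
Proof. by split; exact: measurable_cst. Qed.

Lemma measurable_normc f : cmeasurable f -> measurable_fun setT (normc \o f).
Proof.
move=> [mf1 mf2].
rewrite (_ : normc \o f = Num.sqrt \o (fun x => Re (f x) ^+ 2 + Im (f x) ^+ 2)).
  apply: measurableT_comp; first by apply: continuous_measurable_fun; exact: sqrt_continuous.
  by apply: measurable_funD; exact: measurable_funX.
by apply/funext => x /=; rewrite normc_sqrt.
Qed.

Lemma measurable_expi u : measurable_fun setT u -> cmeasurable (fun x => expi (u x)).
Proof.
move=> mu'; split => /=.
- apply: measurableT_comp => //; apply: continuous_measurable_fun; exact: continuous_cos.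
- apply: measurableT_comp => //; apply: continuous_measurable_fun; exact: continuous_sin.
Qed.

Lemma cintegrable_measurable f : cintegrable f -> cmeasurable f.
Proof. by move=> [/measurable_int/measurable_EFinP ? /measurable_int/measurable_EFinP ?]. Qed.

Lemma cintegrable_le f u : cmeasurable f -> mu.-integrable setT (EFin \o u) ->
  (forall x, normc (f x) <= u x) -> cintegrable f.
Proof.
move=> [mf1 mf2] iu fu; split; apply: le_integrable iu => //; try exact/measurable_EFinP.
- move=> x _; rewrite /= lee_fin (le_trans (Re_le_normc _))// (le_trans (fu x))//.
  exact: ler_norm.
- move=> x _; rewrite /= lee_fin (le_trans (Im_le_normc _))// (le_trans (fu x))//.
  exact: ler_norm.
Qed.

Lemma cintegrable_normc f : cintegrable f -> mu.-integrable setT (EFin \o (normc \o f)).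
Proof.
move=> fi; have [f1 f2] := fi.
have := integrableD measurableT (integrable_norm f1) (integrable_norm f2).
apply: le_integrable => //.
  exact/measurable_EFinP/measurable_normc/cintegrable_measurable.
move=> x _ /=; rewrite lee_fin ger0_norm ?normc_ge0// [leRHS]ger0_norm ?addr_ge0//.
exact: normc_le.
Qed.

Lemma cintegrable_lty f : cmeasurable f ->
  (\int[mu]_x (normc (f x))%:E < +oo)%E -> cintegrable f.
Proof.
move=> mf foo; apply: (@cintegrable_le _ (normc \o f)) => //.
apply/integrableP; split; first exact/measurable_EFinP/measurable_normc.
by under eq_integral do rewrite /= ger0_norm ?normc_ge0//.
Qed.

Lemma cintegrable_real u : mu.-integrable setT (EFin \o u) ->
  cintegrable (fun x => (u x)%:C%C).
Proof. by move=> ui; split => //=; exact: integrable0. Qed.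

Lemma cintegral_real u : cintegral (fun x => (u x)%:C%C) = (\int[mu]_x u x)%:C%C.
Proof. by rewrite /cintegral/= Rintegral_cst// mul0r. Qed.

Lemma cintegrableM f g (M : R) : cintegrable f -> cmeasurable g ->
  (forall x, normc (g x) <= M) -> cintegrable (fun x => f x * g x).
Proof.
move=> fi mg gM; apply: (@cintegrable_le _ (fun x => M * normc (f x))).
- by apply: cmeasurableM => //; exact: cintegrable_measurable.
- exact/integrableZl_EFin/cintegrable_normc.
- move=> x; rewrite ComplexField.Normc.normcM mulrC ler_wpM2r//.
  exact: normc_ge0.
Qed.

Lemma cintegralZl (z : R[i]) f : cintegrable f ->
  cintegral (fun x => z * f x) = z * cintegral f.
Proof.
move=> [f1 f2]; apply: complexP; rewrite ?complex_ReM ?complex_ImM/=.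
- under eq_Rintegral do rewrite complex_ReM.
  rewrite RintegralB//; [|exact: integrableZl_EFin..].
  by rewrite !RintegralZl.
- under eq_Rintegral do rewrite complex_ImM.
  rewrite RintegralD//; [|exact: integrableZl_EFin..].
  by rewrite !RintegralZl.
Qed.

(** Estimating the real and imaginary parts separately costs a factor 2, which
    is harmless in estimates up to constants. *)
Lemma le_normc_cintegral f : cmeasurable f ->
  ((normc (cintegral f))%:E <= 2%:E * \int[mu]_x (normc (f x))%:E)%E.
Proof.
move=> mf; have [->|foo] := eqVneq (\int[mu]_x (normc (f x))%:E)%E +oo%E.
  by rewrite gt0_muley ?leey// lte_fin.
have fi : cintegrable f by apply: cintegrable_lty => //; rewrite ltey.
have [f1 f2] := fi; have nfi := cintegrable_normc fi.
have fin := integrable_fin_num measurableT nfi.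
rewrite -(fineK fin) -EFinM lee_fin (le_trans (normc_le _))//= mulrDl !mul1r.
apply: lerD; (apply: le_trans; first exact: le_normr_Rintegral);
  apply: le_Rintegral => //; try exact: (integrable_norm _).
- by move=> x _; exact: Re_le_normc.
- by move=> x _; exact: Im_le_normc.
Qed.

(** Dominated convergence, applied to real and imaginary parts. *)
Lemma cvg_cintegral (f_ : nat -> T -> R[i]) f u :
  (forall n, cmeasurable (f_ n)) -> cmeasurable f ->
  mu.-integrable setT (EFin \o u) ->
  (forall n x, normc (f_ n x) <= u x) ->
  (forall x, Re (f_ n x) @[n --> \oo] --> Re (f x)) ->
  (forall x, Im (f_ n x) @[n --> \oo] --> Im (f x)) ->
  Re (cintegral (f_ n)) @[n --> \oo] --> Re (cintegral f) /\
  Im (cintegral (f_ n)) @[n --> \oo] --> Im (cintegral f).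
Proof.
move=> mf_ mf ui fu Ref Imf.
have key (h : R[i] -> R) (mh_ : forall n, measurable_fun setT (h \o f_ n))
  (mh : measurable_fun setT (h \o f)) (hn : forall z, `|h z| <= normc z)
  (hf : forall x, h (f_ n x) @[n --> \oo] --> h (f x)) :
  (\int[mu]_x h (f_ n x)) @[n --> \oo] --> \int[mu]_x h (f x).
  have : mu.-integrable setT (EFin \o (h \o f)) /\
      (\int[mu]_x (h (f_ n x))%:E @[n --> \oo] --> \int[mu]_x (h (f x))%:E)%E.
    have [|||||fi _ ?] := @dominated_convergence _ _ _ mu setT measurableT
      (fun n => EFin \o (h \o f_ n)) (EFin \o (h \o f)) (EFin \o u); last by split.
    - by move=> n; exact/measurable_EFinP.
    - exact/measurable_EFinP.
    - apply: aeW => x _; apply: cvg_EFin; last exact: hf.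
      by near=> n.
    - by [].
    - by apply: aeW => x n _ /=; rewrite lee_fin (le_trans (hn _)).
  move=> [fi].
  move=> cvgh; apply: fine_cvg; rewrite fineK//.
  exact: integrable_fin_num fi.
split; apply: key => //.
- by move=> n; exact: (mf_ n).1.
- exact: mf.1.
- exact: Re_le_normc.
- by move=> n; exact: (mf_ n).2.
- exact: mf.2.
- exact: Im_le_normc.
Unshelve. all: by end_near. Qed.

End complex_integral.

Lemma cmeasurable_comp {d1 d2 : measure_display} {T1 : measurableType d1}
  {T2 : measurableType d2} {R : realType} (f : T2 -> R[i]) (h : T1 -> T2) :
  cmeasurable f -> measurable_fun setT h -> cmeasurable (fun x => f (h x)).
Proof.
by move=> [m m'] mh; split; [exact: (measurableT_comp m)|exact: (measurableT_comp m')].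
Qed.

(** * Fubini for complex functions, on products and on tuples *)

Section product_integrals.
Context {d1 d2 : measure_display} {T1 : measurableType d1}
  {T2 : measurableType d2} {R : realType}.
Variables (m1 : {sigma_finite_measure set T1 -> \bar R})
  (m2 : {sigma_finite_measure set T2 -> \bar R}).

(** [Rintegral] turns an infinite inner integral into 0: integrability of
    every section, not only of almost every one, makes the two sides agree
    without discarding null sets. *)
Lemma Rintegral_prod1 (F : T1 * T2 -> R) :
  (m1 \x m2)%E.-integrable setT (EFin \o F) ->
  (forall x, m2.-integrable setT (EFin \o (fun y => F (x, y)))) ->
  \int[(m1 \x m2)%E]_z F z = \int[m1]_x \int[m2]_y F (x, y).
Proof.
move=> Fi F1; rewrite /Rintegral -(integral12_prod_meas1 Fi); congr fine.
apply: eq_integral => x _; rewrite fineK//.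
exact: (integrable_fin_num _ (F1 x)).
Qed.

Lemma Rintegral_prod2 (F : T1 * T2 -> R) :
  (m1 \x m2)%E.-integrable setT (EFin \o F) ->
  (forall y, m1.-integrable setT (EFin \o (fun x => F (x, y)))) ->
  \int[(m1 \x m2)%E]_z F z = \int[m2]_y \int[m1]_x F (x, y).
Proof.
move=> Fi F1; rewrite /Rintegral -(integral21_prod_meas1 Fi); congr fine.
apply: eq_integral => x _; rewrite fineK//.
exact: (integrable_fin_num _ (F1 x)).
Qed.

Lemma cmeasurable_section (F : T1 * T2 -> R[i]) : cmeasurable F ->
  (forall x, cmeasurable (fun y => F (x, y))) /\
  (forall y, cmeasurable (fun x => F (x, y))).
Proof.
by move=> mF; split => x; [exact: (cmeasurable_comp mF (pair1_measurable x))|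
                          exact: (cmeasurable_comp mF (pair2_measurable x))].
Qed.

(** Tonelli is applied to the positive and negative parts, so that F may fail
    to be integrable over the product, as the integrand of a Fourier transform
    does. *)
Lemma measurable_integral_section (F : T1 * T2 -> R) : measurable_fun setT F ->
  measurable_fun setT (fun x => \int[m2]_y F (x, y)).
Proof.
move=> mF; apply: (measurableT_comp (@fine_measurable _ _ measurableT)) => //.
have mF' : measurable_fun setT (EFin \o F) by exact/measurable_EFinP.
rewrite (_ : (fun x => \int[m2]_y (F (x, y))%:E)%E =
  (fun x => \int[m2]_y ((EFin \o F)^\+ (x, y)) -
    \int[m2]_y ((EFin \o F)^\- (x, y)))%E); last first.
  apply/funext => x; rewrite integralE; congr (_ - _)%E.
    by apply: eq_integral => y _; rewrite !funeposE.
  by apply: eq_integral => y _; rewrite !funenegE.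
apply: emeasurable_funB.
- exact: (measurable_fun_fubini_tonelli_F (m2 := m2) ((EFin \o F)^\+)%E
    (measurable_funepos mF') (fun z => funepos_ge0 _ z)).
- exact: (measurable_fun_fubini_tonelli_F (m2 := m2) ((EFin \o F)^\-)%E
    (measurable_funeneg mF') (fun z => funeneg_ge0 _ z)).
Qed.

Lemma cmeasurable_cintegral (F : T1 * T2 -> R[i]) : cmeasurable F ->
  cmeasurable (fun x => cintegral m2 (fun y => F (x, y))).
Proof.
by move=> [m m']; split; rewrite /comp/=;
  [exact: (measurable_integral_section m)|exact: (measurable_integral_section m')].
Qed.

Lemma cintegrable_prod (f : T1 -> R[i]) (g : T2 -> R[i]) (k : T1 * T2 -> R[i]) :
  cintegrable m1 f -> cintegrable m2 g -> cmeasurable k ->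
  (forall z, normc (k z) <= 1) ->
  cintegrable (m1 \x m2)%E (fun z => f z.1 * g z.2 * k z).
Proof.
move=> fi gi mk k1.
have mf := cintegrable_measurable fi; have mg := cintegrable_measurable gi.
have mf1 : cmeasurable (fun z : T1 * T2 => f z.1).
  exact: (cmeasurable_comp mf measurable_fst).
have mg2 : cmeasurable (fun z : T1 * T2 => g z.2).
  exact: (cmeasurable_comp mg measurable_snd).
apply: (@cintegrable_le _ _ _ _ _ (fun z => normc (f z.1) * normc (g z.2))).
- by do 2 apply: cmeasurableM => //.
- apply/integrable12ltyP.
    apply/measurable_EFinP/measurable_funM.
      exact: measurable_normc.
    exact: measurable_normc.
  have nf := cintegrable_normc fi; have ng := cintegrable_normc gi.
  have [_ foo] := integrableP _ _ _ nf.
  have [_ goo] := integrableP _ _ _ ng.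
  under eq_integral => x _.
    under eq_integral => y _ do rewrite /= normrM EFinM.
    rewrite ge0_integralZl//.
  over.
    by move: ng => /integrable_norm/measurable_int.
  rewrite ge0_integralZr//; last 2 first.
    by move: nf => /integrable_norm/measurable_int.
    exact: integral_ge0.
  by rewrite lte_mul_pinfty// ?integral_ge0// ge0_fin_numE// integral_ge0.
- move=> z; rewrite !ComplexField.Normc.normcM -[leRHS]mulr1 ler_wpM2l//.
  by rewrite mulr_ge0// normc_ge0.
Qed.

(** The complex double integrals of Fourier analysis below all have this shape:
    an integrable function of each variable times a kernel bounded by 1. *)
Lemma cintegral_fubini (f : T1 -> R[i]) (g : T2 -> R[i]) (k : T1 * T2 -> R[i]) :
  cintegrable m1 f -> cintegrable m2 g -> cmeasurable k ->
  (forall z, normc (k z) <= 1) ->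
  cintegral m1 (fun x => cintegral m2 (fun y => f x * g y * k (x, y))) =
  cintegral m2 (fun y => cintegral m1 (fun x => f x * g y * k (x, y))).
Proof.
move=> fi gi mk k1; have [Fr Fi] := cintegrable_prod fi gi mk k1.
have [mk1 mk2] := cmeasurable_section mk.
have s1 x : cintegrable m2 (fun y => f x * g y * k (x, y)).
  apply: (@cintegrable_le _ _ _ _ _ (fun y => normc (f x) * normc (g y))).
  - apply: cmeasurableM => //; apply: cmeasurableM; first exact: cmeasurable_cst.
    exact: cintegrable_measurable gi.
  - exact/integrableZl_EFin/cintegrable_normc.
  - move=> y; rewrite !ComplexField.Normc.normcM -[leRHS]mulr1 ler_wpM2l//.
    by rewrite mulr_ge0// normc_ge0.
have s2 y : cintegrable m1 (fun x => f x * g y * k (x, y)).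
  apply: (@cintegrable_le _ _ _ _ _ (fun x => normc (g y) * normc (f x))).
  - apply: cmeasurableM => //; apply: cmeasurableM; last exact: cmeasurable_cst.
    exact: cintegrable_measurable fi.
  - exact/integrableZl_EFin/cintegrable_normc.
  - move=> x; rewrite !ComplexField.Normc.normcM [leRHS]mulrC -[leRHS]mulr1 ler_wpM2l//.
    by rewrite mulr_ge0// normc_ge0.
apply: complexP => /=.
- rewrite -(Rintegral_prod1 Fr (fun x => (s1 x).1)).
  by rewrite (Rintegral_prod2 Fr (fun y => (s2 y).1)).
- rewrite -(Rintegral_prod1 Fi (fun x => (s1 x).2)).
  by rewrite (Rintegral_prod2 Fi (fun y => (s2 y).2)).
Qed.

End product_integrals.

Section cons_integrals.
Context {dT : measure_display} {T : measurableType dT} {R : realType}.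
Variables (n : nat) (m1 : {sigma_finite_measure set T -> \bar R})
  (m2 : {sigma_finite_measure set (n.-tuple T) -> \bar R}).

Lemma ge0_integral_cons (F : n.+1.-tuple T -> \bar R) :
  measurable_fun setT F -> (forall t, 0 <= F t)%E ->
  (\int[cons_measure m1 m2]_t F t =
   \int[m1]_x \int[m2]_t F (tuple_cons (x, t)))%E.
Proof.
move=> mF F0; rewrite ge0_integral_pushforward//; last exact: measurable_tuple_cons.
rewrite preimage_setT fubini_tonelli1//; last by move=> z; exact: F0.
by apply: measurableT_comp => //; exact: measurable_tuple_cons.
Qed.

Lemma integrable_cons (F : n.+1.-tuple T -> R) : measurable_fun setT F ->
  (m1 \x m2)%E.-integrable setT (EFin \o (F \o (@tuple_cons _ T n))) ->
  (cons_measure m1 m2).-integrable setT (EFin \o F) /\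
  \int[cons_measure m1 m2]_t F t = \int[(m1 \x m2)%E]_z F (tuple_cons z).
Proof.
move=> mF Fi; split.
  apply: (@integrable_pushforward _ _ _ _ _ (@tuple_cons _ T n)) => //.
  - exact: measurable_tuple_cons.
  - exact/measurable_EFinP.
rewrite /Rintegral; congr fine.
rewrite (@integral_pushforward _ _ _ _ _ (@tuple_cons _ T n)) ?preimage_setT//.
- exact: measurable_tuple_cons.
- exact/measurable_EFinP.
Qed.

Lemma cintegral_cons (f : T -> R[i]) (g : n.-tuple T -> R[i])
    (F : n.+1.-tuple T -> R[i]) : cmeasurable F ->
  (forall x t, F (tuple_cons (x, t)) = f x * g t) ->
  cintegrable m1 f -> cintegrable m2 g ->
  cintegrable (cons_measure m1 m2) F /\
  cintegral (cons_measure m1 m2) F = cintegral m1 f * cintegral m2 g.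
Proof.
move=> [mF1 mF2] FE fi gi.
have one_le1 (z : T * n.-tuple T) : normc (1 : R[i]) <= 1.
  by rewrite ComplexField.Normc.normc1.
have Pi := cintegrable_prod fi gi (cmeasurable_cst 1) one_le1.
have PE : (fun z => f z.1 * g z.2 * 1) = F \o (@tuple_cons _ T n).
  by apply/funext => -[x t] /=; rewrite mulr1 FE.
rewrite PE in Pi; have [P1 P2] := Pi.
have [F1 F1E] := integrable_cons mF1 P1.
have [F2 F2E] := integrable_cons mF2 P2.
have gx x : cintegrable m2 (fun t => F (tuple_cons (x, t))).
  have -> : (fun t => F (tuple_cons (x, t))) = (fun t => g t * f x).
    by apply/funext => t; rewrite FE mulrC.
  by apply: (cintegrableM gi (cmeasurable_cst _)) => t; exact: lexx.
split => //; rewrite mulrC -cintegralZl//; apply: complexP => /=.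
- rewrite [LHS]F1E (Rintegral_prod1 P1 (fun x => (gx x).1)).
  apply: eq_Rintegral => x _; rewrite mulrC -[in RHS]cintegralZl//=.
  by apply: eq_Rintegral => t _ /=; rewrite FE.
- rewrite [LHS]F2E (Rintegral_prod1 P2 (fun x => (gx x).2)).
  apply: eq_Rintegral => x _; rewrite mulrC -[in RHS]cintegralZl//=.
  by apply: eq_Rintegral => t _ /=; rewrite FE.
Qed.

End cons_integrals.

(** * Continuous functions of a vector are measurable *)

Section tuple_measurability.
Variables (R : realType) (d : nat).
Implicit Types (u : 'rV[R]_d -> R) (f : 'rV[R]_d -> R[i]).
Local Notation T := (d.-tuple (measurableTypeR R)).

Lemma measurable_coord (i : 'I_d) :
  measurable_fun [set: T] (fun t => vec t 0 i).
Proof.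
rewrite (_ : (fun t => _) = (fun t : T => tnth t i)); first exact: measurable_tnth.
by apply/funext => t; rewrite mxE.
Qed.

Lemma measurable_vec_ball (q : 'rV[R]_d) (r : R) :
  measurable [set t : T | ball q r (vec t)].
Proof.
have [r0|r0] := leP r 0.
  rewrite (_ : [set t | _] = set0)//; apply/seteqP; split=> // t /= [].
  by rewrite ltNge r0.
rewrite (_ : [set t | _] = \bigcap_(i in [set: 'I_d]) (setT `&`
   ((fun t : T => vec t 0 i) @^-1` (ball (q 0 i) r)))).
  apply: fin_bigcap_measurable => // i _; apply: measurable_coord => //.
  exact: measurable_ball.
apply/seteqP; split => t /=.
  by move=> [_ qt] i _; split => //; exact: qt.
move=> qt; split => // i j; rewrite (ord1 i).
by have [] := qt j I.
Qed.

(** An open set is the union of the countably many balls with rational centre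
    and radius 1 / (n + 1) that it contains; for the maximum norm these balls
    are boxes, hence measurable for the product sigma-algebra. *)
Lemma measurable_vec_open (U : set 'rV[R]_d) : open U ->
  measurable [set t : T | U (vec t)].
Proof.
move=> oU.
pose q (p : 'rV[rat]_d * nat) : 'rV[R]_d := map_mx ratr p.1.
pose r (p : 'rV[rat]_d * nat) : R := p.2.+1%:R^-1.
pose F (p : 'rV[rat]_d * nat) : set T :=
  if `[< ball (q p) (r p) `<=` U >] then [set t : T | ball (q p) (r p) (vec t)] else set0.
rewrite (_ : [set t | _] = \bigcup_p F p).
  apply: countable_bigcupT_measurable => //= p; rewrite /F; case: ifP => // _.
  exact: measurable_vec_ball.
apply/seteqP; split => [t /= Ut|t [p _]]; last first.
  by rewrite /F; case: ifPn => // /asboolP + /=; exact.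
have /nbhs_ballP[e /= e0 eU] : nbhs (vec t) U by rewrite nbhsE/=; exists U.
have [n ne] : exists n, n.+1%:R^-1 < e / 2.
  have := near_infty_natSinv_lt (PosNum (divr_gt0 e0 (ltr0n R 2))).
  by move=> [n _ /(_ n (leqnn n))] /=; exists n.
have n0 : 0 < n.+1%:R^-1 :> R by rewrite invr_gt0.
have ex i : exists s : rat, `|vec t 0 i - ratr s| < n.+1%:R^-1.
  have : vec t 0 i - n.+1%:R^-1 < vec t 0 i + n.+1%:R^-1 by rewrite ltrD2l gtrN.
  move=> /rat_in_itvoo[s]; rewrite in_itv/= => /andP[s1 s2]; exists s.
  rewrite ltr_norml; apply/andP.
  by split; [rewrite ltrBrDl -ltrBrDr opprK|rewrite ltrBlDr -ltrBlDl].
have [s sP] := choice ex.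
exists (\row_i s i, n) => //; rewrite /F ifT.
  split => //= i j; rewrite (ord1 i) /q !mxE/= /ball/= distrC.
  by have := sP j; rewrite mxE.
apply/asboolP => y [_ /= qy]; apply: eU; split => // i j.
rewrite (ord1 i); have {qy} := qy 0 j; rewrite /q /ball/= !mxE/= => qy.
have := sP j; rewrite mxE => sj.
rewrite -(subrKA (ratr (s j))).
by rewrite (le_lt_trans (ler_normD _ _))// (lt_trans (ltrD sj qy))// /r/= [ltRHS]splitr ltrD.
Qed.

Lemma measurable_vec_continuous u : continuous u ->
  measurable_fun [set: T] (fun t => u (vec t)).
Proof.
move=> /continuousP cu; apply: (measurability _ (RGenOpens.measurableE R)).
move=> _ [_ [a [b ->] <-]]; rewrite setTI.
apply: (@measurable_vec_open (u @^-1` `]a, b[)); apply: cu.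
exact: interval_open.
Qed.

Lemma cmeasurable_ccontinuous f : ccontinuous f ->
  cmeasurable (fun t : T => f (vec t)).
Proof.
by move=> [c1 c2]; split;
  [exact: measurable_vec_continuous c1|exact: measurable_vec_continuous c2].
Qed.

End tuple_measurability.

(** * Affine substitutions *)

Section affine_substitution.
Variable R : realType.
Local Open Scope ereal_scope.

(** Uniqueness of Lebesgue measure reduces this to the length of an
    interval. *)
Lemma lebesgue_measure_affine (a b : R) (A : set (measurableTypeR R)) : (0 < a)%R ->
  measurable A ->
  lebesgue_measure A = a%:E *
    pushforward (@lebesgue_measure R)
      ((fun x => a * x + b)%R : measurableTypeR R -> measurableTypeR R) A.
Proof.
move=> a0 mA.
have mphi : measurable_fun [set: measurableTypeR R]
    ((fun x => a * x + b)%R : measurableTypeR R -> measurableTypeR R).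
  by apply: measurable_funD => //; apply: measurable_funM.
pose phi : measurableTypeR R -> measurableTypeR R := (fun x => a * x + b)%R.
(* [nu] still awaits the measurability of the substitution as an argument. *)
pose nu : {measure set (measurableTypeR R) -> \bar R} :=
  mscale (NngNum (ltW a0)) (pushforward (@lebesgue_measure R) phi).
rewrite (@lebesgue_measure_unique R (nu mphi)) // => _ [[x y]] _ <-.
rewrite /nu/= /mscale/= /pushforward.
rewrite (_ : phi @^-1` _ = [set` `]((x - b) / a)%R, ((y - b) / a)%R]]); last first.
  apply/seteqP; split => z /=; rewrite !in_itv/=.
    by rewrite ltr_pdivrMr// ler_pdivlMr// mulrC -ltrBlDr -lerBrDr.
  by rewrite ltr_pdivrMr// ler_pdivlMr// ![(z * a)%R]mulrC -ltrBlDr -lerBrDr.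
rewrite !lebesgue_measure_itv/= !lte_fin ltr_pM2r ?invr_gt0// ltrD2r.
case: ifPn => _; last by rewrite mule0.
by rewrite -!EFinD -EFinM; congr EFin; field; rewrite gt_eqF.
Qed.

Lemma ge0_integral_affine1 (a b : R) (F : measurableTypeR R -> \bar R) : (0 < a)%R ->
  measurable_fun setT F -> (forall x, 0 <= F x) ->
  \int[@lebesgue_measure R]_x F (a * x + b)%R =
  (a^-1)%:E * \int[@lebesgue_measure R]_x F x.
Proof.
move=> a0 mF F0.
have mphi : measurable_fun [set: measurableTypeR R]
    ((fun x => a * x + b)%R : measurableTypeR R -> measurableTypeR R).
  by apply: measurable_funD => //; apply: measurable_funM.
pose phi : measurableTypeR R -> measurableTypeR R := (fun x => a * x + b)%R.
rewrite [in RHS](@eq_measure_integral _ _ _ _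
  (mscale (NngNum (ltW a0)) (pushforward (@lebesgue_measure R) phi))); last first.
  by move=> A mA _; exact: lebesgue_measure_affine.
rewrite ge0_integral_mscale//= muleA -EFinM mulVf ?gt_eqF// mul1e.
by rewrite ge0_integral_pushforward//.
Qed.

Definition affine_tuple d (a : R) (b : 'rV[R]_d) (t : d.-tuple (measurableTypeR R)) :
  d.-tuple (measurableTypeR R) := [tuple (a * tnth t i + b 0 i)%R | i < d].

Lemma vec_affine_tuple d (a : R) (b : 'rV[R]_d) t :
  vec (affine_tuple a b t) = (a *: vec t + b)%R.
Proof. by apply/rowP => i; rewrite !mxE tnth_mktuple. Qed.

Lemma measurable_affine_tuple d (a : R) (b : 'rV[R]_d) :
  measurable_fun setT (affine_tuple a b).
Proof.
apply/measurable_fun_tnthP => i.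
rewrite (_ : _ \o _ = fun t => a * tnth t i + b 0 i)%R.
  apply: measurable_funD => //; apply: measurable_funM => //.
  exact: measurable_tnth.
by apply/funext => t /=; rewrite tnth_mktuple.
Qed.

(** Induction on d: by Tonelli, the substitution is made one coordinate at a
    time. *)
Lemma ge0_integral_affine d (a : R) (b : 'rV[R]_d)
    (F : d.-tuple (measurableTypeR R) -> \bar R) : (0 < a)%R ->
  measurable_fun setT F -> (forall t, 0 <= F t) ->
  \int[lebesgue_tuple R d]_t F (affine_tuple a b t) =
  (a ^- d)%:E * \int[lebesgue_tuple R d]_t F t.
Proof.
move=> a0; elim: d b F => [|d IH] b F mF F0.
  by rewrite expr0 invr1 mul1e; apply: eq_integral => t _; rewrite tuple0 (tuple0 t).
pose b' : 'rV[R]_d := (\row_i b 0 (lift ord0 i))%R.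
have affE x t : affine_tuple a b (tuple_cons (x, t)) =
    tuple_cons ((a * x + b 0 ord0)%R, affine_tuple a b' t).
  apply: eq_from_tnth => i; rewrite tnth_mktuple.
  case: (unliftP ord0 i) => [j|] -> /=; last by rewrite !tnth0.
  by rewrite !tnthS tnth_mktuple mxE.
have mcons y : measurable_fun setT (fun t : d.-tuple (measurableTypeR R) => F (tuple_cons (y, t))).
  apply: (measurableT_comp mF); apply: (measurableT_comp (@measurable_tuple_cons _ _ d)).
  exact: pair1_measurable.
rewrite /= !ge0_integral_cons//; last first.
  by apply: (measurableT_comp mF); exact: measurable_affine_tuple.
under eq_integral => x _.
  under eq_integral => t _ do rewrite affE.
  rewrite (IH b' (fun t => F (tuple_cons (_, t))))//.
over.
have mG : measurable_fun setT (fun y => \int[lebesgue_tuple R d]_t F (tuple_cons (y, t))).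
  apply: (measurable_fun_fubini_tonelli_F (m2 := lebesgue_tuple R d) (F \o (@tuple_cons _ _ d))).
    by apply: (measurableT_comp mF); exact: measurable_tuple_cons.
  by move=> z; exact: F0.
have a0d : 0 <= (a ^- d)%:E by rewrite lee_fin invr_ge0 exprn_ge0// ltW.
have mGa : measurable_fun setT
    (fun x : measurableTypeR R => \int[lebesgue_tuple R d]_t F (tuple_cons ((a * x + b 0 ord0)%R, t))).
  apply: (measurableT_comp mG).
  by apply: measurable_funD => //; apply: measurable_funM.
rewrite (ge0_integralZl _ measurableT mGa _ a0d); last first.
  by move=> x _; exact: integral_ge0.
rewrite (ge0_integral_affine1 _ a0 mG); last by move=> x; exact: integral_ge0.
by rewrite muleA -EFinM exprSr invfM.
Qed.

Lemma Rintegral_affine d (a : R) (b : 'rV[R]_d)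
    (u : d.-tuple (measurableTypeR R) -> R) : (0 < a)%R ->
  (lebesgue_tuple R d).-integrable setT (EFin \o u) ->
  (\int[lebesgue_tuple R d]_t u (affine_tuple a b t) =
   a ^- d * \int[lebesgue_tuple R d]_t u t)%R.
Proof.
move=> a0 ui; have m := measurable_int _ ui.
rewrite /Rintegral integralE [in RHS]integralE.
transitivity (fine (\int[lebesgue_tuple R d]_t (EFin \o u)^\+ (affine_tuple a b t) -
    \int[lebesgue_tuple R d]_t (EFin \o u)^\- (affine_tuple a b t))).
  by congr (fine (_ - _)); apply: eq_integral => t _; rewrite ?funeposE ?funenegE.
rewrite (ge0_integral_affine b a0 (measurable_funepos m))//.
rewrite (ge0_integral_affine b a0 (measurable_funeneg m))//.
have [p n] := (integrable_pos_fin_num measurableT ui, integrable_neg_fin_num measurableT ui).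
by rewrite -(fineK p) -(fineK n) -!EFinM -!EFinB/= mulrBr.
Qed.

Lemma cintegral_affine d (a : R) (b : 'rV[R]_d)
    (f : d.-tuple (measurableTypeR R) -> R[i]) : (0 < a)%R ->
  cintegrable (lebesgue_tuple R d) f ->
  (cintegral (lebesgue_tuple R d) (fun t => f (affine_tuple a b t)) =
   (a ^- d)%:C%C * cintegral (lebesgue_tuple R d) f)%R.
Proof.
move=> a0 [f1 f2]; apply: complexP; rewrite ?complex_ReM ?complex_ImM/= !mul0r ?subr0 ?addr0.
- exact: (Rintegral_affine b a0 f1).
- exact: (Rintegral_affine b a0 f2).
Qed.

Lemma integrable_affine d (a : R) (b : 'rV[R]_d)
    (u : d.-tuple (measurableTypeR R) -> R) : (0 < a)%R ->
  (lebesgue_tuple R d).-integrable setT (EFin \o u) ->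
  (lebesgue_tuple R d).-integrable setT (EFin \o (u \o affine_tuple a b)).
Proof.
move=> a0 /integrableP[mu uoo]; apply/integrableP; split.
  exact: (measurableT_comp mu (measurable_affine_tuple a b)).
rewrite (ge0_integral_affine b a0 (F := fun t => `|(u t)%:E|))//; last first.
  exact: measurableT_comp.
by rewrite lte_mul_pinfty// lee_fin invr_ge0 exprn_ge0// ltW.
Qed.

Lemma cintegrable_affine d (a : R) (b : 'rV[R]_d)
    (f : d.-tuple (measurableTypeR R) -> R[i]) : (0 < a)%R ->
  cintegrable (lebesgue_tuple R d) f ->
  cintegrable (lebesgue_tuple R d) (fun t => f (affine_tuple a b t)).
Proof.
by move=> a0 [f1 f2]; split; [exact: integrable_affine f1|exact: integrable_affine f2].
Qed.

End affine_substitution.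

(** * The Poisson kernel and its products *)

Section poisson_kernel.
Variable R : realType.
Local Notation mu := (@lebesgue_measure R).
Implicit Types x z : R.

Lemma continuous_lexpcos z : continuous (fun x => expR (- `|x|) * (1 + cos (x * z)) : R).
Proof.
move=> x; apply: cvgM.
  apply: continuous_comp; last exact: continuous_expR.
  by apply: cvgN; exact: norm_continuous.
apply: cvgD; first exact: cvg_cst.
apply: (@continuous_comp _ _ _ (fun x : R => x * z) cos); last exact: continuous_cos.
exact: mulrr_continuous.
Qed.

(** Adding 1 to the cosine makes the integrand nonnegative, as the fundamental
    theorem of calculus on a half-line requires. *)
Lemma integral_lexpcos_half z :
  (\int[mu]_(x in `[0%R, +oo[) (expR (- `|x|) * (1 + cos (x * z)))%:E =
   (1 + (1 + z ^+ 2)^-1)%:E)%E.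
Proof.
pose k := (1 + z ^+ 2)^-1.
have k0 : 0 < k by rewrite invr_gt0 ltr_pwDl// sqr_ge0.
have zk : (1 + z ^+ 2) * k = 1 by rewrite mulfV// gt_eqF// ltr_pwDl// sqr_ge0.
(* F is the primitive that vanishes at infinity. *)
pose F x := expR (- x) * (k * (z * sin (x * z) - cos (x * z)) - 1).
have dF x : is_derive x 1 F (expR (- x) * (1 + cos (x * z))).
  have d1 : is_derive x 1 (fun x => expR (- x)) (- expR (- x)).
    have -> : (fun x => expR (- x)) = expR \o -%R :> (R -> R) by [].
    by apply: is_derive_eq; rewrite mulrN1.
  have dz : is_derive x (1 : R) (fun x : R => x * z) z.
    by apply: is_derive_eq; rewrite scaler0 add0r /GRing.scale/= mulr1.
  have d2 : is_derive x 1 (fun x => sin (x * z)) (z * cos (x * z)).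
    have -> : (fun x => sin (x * z)) = sin \o (fun x => x * z) :> (R -> R) by [].
    by apply: is_derive_eq; rewrite mulrC.
  have d3 : is_derive x 1 (fun x => cos (x * z)) (z * - sin (x * z)).
    have -> : (fun x => cos (x * z)) = cos \o (fun x => x * z) :> (R -> R) by [].
    by apply: is_derive_eq; rewrite mulrC.
  rewrite /F; apply: is_derive_eq.
  rewrite /GRing.scale/=.
  set E := expR _; set S := sin _; set C := cos _.
  have -> : 1 + C = 1 + (1 + z ^+ 2) * k * C by rewrite zk mul1r.
  ring.
rewrite (@ge0_continuous_FTC2y R _ F 0 0).
- rewrite sub0e /F oppr0 expR0 !mul0r sin0 cos0 -EFinN; congr EFin; rewrite -/k; ring.
- by move=> x _; rewrite mulr_ge0 ?expR_ge0// -lerBlDl sub0r cos_geN1.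
- by apply: continuous_subspaceT; exact: continuous_lexpcos.
- have bF x : `|F x| <= expR (- x) * (k * (`|z| + 1) + 1).
    rewrite /F normrM ger0_norm ?expR_ge0// ler_wpM2l ?expR_ge0//.
    rewrite (le_trans (ler_normB _ _))// normr1 lerD2r normrM gtr0_norm//.
    rewrite ler_wpM2l// ?(ltW k0)// (le_trans (ler_normB _ _))// lerD//.
      by rewrite normrM ler_piMr// ler_norml sin_geN1 sin_le1.
    by rewrite ler_norml cos_geN1 cos_le1.
  have e0 (c : R) : expR (- x) * c @[x --> +oo] --> (0 : R).
    by rewrite -(mul0r c); apply: cvgMr_tmp; exact: cvgr_expR.
  apply: (@squeeze_cvgr _ _ _ _ (fun x => expR (- x) * - (k * (`|z| + 1) + 1))
      (fun x => expR (- x) * (k * (`|z| + 1) + 1))); [|exact: e0|exact: e0].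
  by near=> x; rewrite mulrN -ler_norml.
- by move=> x _; apply: ex_derive.
- apply: cvg_at_right_filter; apply: differentiable_continuous.
  by apply/derivable1_diffP; apply: ex_derive.
- move=> x; rewrite in_itv/= andbT => x0; rewrite derive1E derive_val.
  by rewrite gtr0_norm.
Unshelve. all: by end_near. Qed.

Lemma integral_lexpcos z :
  (\int[mu]_x (expR (- `|x|) * (1 + cos (x * z)))%:E =
   (2 * (1 + (1 + z ^+ 2)^-1))%:E)%E.
Proof.
rewrite ge0_symfun_integralT.
- rewrite -set_itvcy integral_lexpcos_half EFinM//.
- by move=> x; rewrite mulr_ge0 ?expR_ge0// -lerBlDl sub0r cos_geN1.
- exact: continuous_lexpcos.
- by move=> x /=; rewrite normrN mulNr cosN.
Qed.

Lemma measurable_lexp : measurable_fun setT (fun x : R => expR (- `|x|)).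
Proof.
apply: continuous_measurable_fun => x.
apply: continuous_comp; last exact: continuous_expR.
by apply: cvgN; exact: norm_continuous.
Qed.

Lemma integrable_lexp : mu.-integrable setT (EFin \o (fun x => expR (- `|x|))).
Proof.
apply/integrableP; split.
  by apply/measurable_EFinP; exact: measurable_lexp.
have := integral_lexpcos 0.
under eq_integral => x _ do rewrite mulr0 cos0 mulrC EFinM.
rewrite ge0_integralZl//; last first.
  by apply/measurable_EFinP; exact: measurable_lexp.
under [in X in _ -> X]eq_integral => x _ do rewrite /= ger0_norm ?expR_ge0//.
by case: (\int[_]_(_ in _) _)%E => // [r|]; rewrite ?ltry// mulry gtr0_sg ?mul1e.
Qed.

Lemma Rintegral_odd (u : R -> R) : mu.-integrable setT (EFin \o u) ->
  (forall x, u (- x) = - u x) -> \int[mu]_x u x = 0.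
Proof.
move=> ui uN.
have mN : measurable_fun [set: measurableTypeR R] (-%R : measurableTypeR R -> measurableTypeR R).
  exact: oppr_measurable.
have iN : mu.-integrable setT ((EFin \o u) \o -%R).
  apply: eq_integrable (integrableN ui) => // x _ /=; by rewrite uN.
have : \int[mu]_x u x = - \int[mu]_x u x.
  rewrite {1}/Rintegral (@eq_measure_integral _ _ _ _
    (pushforward mu (-%R : measurableTypeR R -> measurableTypeR R))); last first.
    by move=> A mA _; apply/esym; exact: lebesgue_measureN.
  rewrite integral_pushforward//; last exact: measurable_int ui.
  rewrite preimage_setT -fineN -integralN/=; last exact: integrable_add_def.
  by congr fine; apply: eq_integral => x _ /=; rewrite uN.
lra.
Qed.

(** Up to a factor 2 * pi, the Poisson kernel of the half-plane at height 1. *)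
Definition poisson z : R := 2 / (1 + z ^+ 2).

Lemma cintegrable_lexp z :
  cintegrable mu (fun x => (expR (- `|x|))%:C%C * expi (- (x * z))).
Proof.
apply: (cintegrableM (M := 1)); first exact: (cintegrable_real integrable_lexp).
  apply: measurable_expi; apply: measurable_funN; exact: measurable_funM.
by move=> x; rewrite normc_expi.
Qed.

(** The cosine part is the difference of two instances of
    [integral_lexpcos], at z and at 0; the sine part is odd. *)
Lemma fourier_lexp z :
  cintegral mu (fun x => (expR (- `|x|))%:C%C * expi (- (x * z))) =
  (poisson z)%:C%C.
Proof.
have [i1 i2] := cintegrable_lexp z.
have Rlexpcos y : mu.-integrable setT (EFin \o (fun x => expR (- `|x|) * cos (x * y))) ->
    \int[mu]_x expR (- `|x|) + \int[mu]_x (expR (- `|x|) * cos (x * y)) =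
    2 * (1 + (1 + y ^+ 2)^-1).
  move=> iy; rewrite -RintegralD//; last exact: integrable_lexp.
  rewrite /Rintegral; under eq_integral => x _ do rewrite -[X in X + _]mulr1 -mulrDr.
  by rewrite integral_lexpcos.
apply: complexP => /=.
- have E y : (fun x => expR (- `|x|) * cos (- (x * y)) - 0 * sin (- (x * y))) =
      (fun x => expR (- `|x|) * cos (x * y)) by apply/funext => x; rewrite cosN mul0r subr0.
  have c0 : (fun x => expR (- `|x|) * cos (x * 0)) = (fun x => expR (- `|x|)) :> (R -> R).
    by apply/funext => x; rewrite mulr0 cos0 mulr1.
  have := Rlexpcos 0; rewrite c0 => /(_ integrable_lexp).
  rewrite expr0n/= addr0 invr1 => h0.
  have i1' : mu.-integrable setT (EFin \o (fun x => expR (- `|x|) * cos (x * z))).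
    by rewrite -E; exact: i1.
  have h1 := Rlexpcos z i1'; rewrite E.
  rewrite /poisson; move: h0 h1; set a := Rintegral _ _ _; set b := Rintegral _ _ _; lra.
- apply: Rintegral_odd i2 _ => x /=.
  by rewrite normrN !mul0r !addr0 mulNr opprK sinN mulrN opprK.
Qed.

Lemma poisson_ge0 z : 0 <= poisson z.
Proof. by rewrite divr_ge0// addr_ge0// sqr_ge0. Qed.

Lemma continuous_poisson : continuous poisson.
Proof. by move=> z; apply: cvgMl_tmp; exact: continuous_oneDsqrV. Qed.

Lemma integral_poisson : (\int[mu]_z (poisson z)%:E = (2 * pi)%:E)%E.
Proof.
rewrite ge0_symfun_integralT; last 3 first.
- exact: poisson_ge0.
- exact: continuous_poisson.
- by move=> z /=; rewrite /poisson sqrrN.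
rewrite -set_itvcy; under eq_integral => z _ do rewrite EFinM.
rewrite ge0_integralZl//; last 2 first.
- apply/measurable_EFinP; apply: measurable_funTS; apply: continuous_measurable_fun => z.
  exact: continuous_oneDsqrV.
- by move=> z _; rewrite lee_fin invr_ge0 addr_ge0// sqr_ge0.
rewrite integral0y_oneDsqr -!EFinM; congr EFin; by field.
Qed.

Lemma integrable_poisson : mu.-integrable setT (EFin \o poisson).
Proof.
apply/integrableP; split.
  by apply/measurable_EFinP; apply: continuous_measurable_fun; exact: continuous_poisson.
under eq_integral => x _ do rewrite /= ger0_norm ?poisson_ge0//.
by rewrite integral_poisson ltry.
Qed.

End poisson_kernel.

Section tuple_products.
Variable R : realType.
Local Notation mu := (@lebesgue_measure R).

Lemma cmeasurable_prod (dT : measure_display) (T : measurableType dT) d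
    (G : 'I_d -> T -> R[i]) : (forall i, cmeasurable (G i)) ->
  cmeasurable (fun t => \prod_i G i t).
Proof.
elim: d G => [|d IH] G mG.
  by under [X in cmeasurable X]funext => t do rewrite big_ord0; exact: cmeasurable_cst.
under [X in cmeasurable X]funext => t do rewrite big_ord_recl.
by apply: cmeasurableM => //; exact: IH.
Qed.

Lemma cintegral_prod d (G : 'I_d -> R -> R[i]) :
  (forall i, cintegrable mu (G i)) ->
  cintegrable (lebesgue_tuple R d) (fun t => \prod_i G i (tnth t i)) /\
  cintegral (lebesgue_tuple R d) (fun t => \prod_i G i (tnth t i)) =
  \prod_i cintegral mu (G i).
Proof.
elim: d G => [|d IH] G Gi.
  rewrite big_ord0.
  have -> : (fun t : 0.-tuple (measurableTypeR R) => \prod_(i < 0) G i (tnth t i)) = (fun=> 1).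
    by apply/funext => t; rewrite big_ord0.
  have i1 (c : R) : (lebesgue_tuple R 0).-integrable setT (EFin \o cst c).
    apply/integrableP; split; first by apply/measurable_EFinP; exact: measurable_cst.
    by rewrite /= integral_dirac// diracT mul1e ltry.
  split; first by split; exact: i1.
  have c (r : R) : \int[lebesgue_tuple R 0]_x r = r.
    by rewrite Rintegral_cst// [X in fine X](_ : _ = 1%E) ?mulr1//; exact: diracT.
  by apply: complexP; exact: c.
have [gi gE] := IH (fun i => G (lift ord0 i)) (fun i => Gi _).
rewrite big_ord_recl -gE; apply: cintegral_cons => //.
  apply: cmeasurable_prod => i.
  by apply: (cmeasurable_comp (cintegrable_measurable (Gi i))); exact: measurable_tnth.
move=> x t; rewrite big_ord_recl tnth0; congr (_ * _).
by apply: eq_bigr => i _; rewrite tnthS.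
Qed.

End tuple_products.

Section poisson_vec.
Variables (R : realType) (d : nat).
Local Notation T := (d.-tuple (measurableTypeR R)).
Local Notation leb := (lebesgue_tuple R d).
Implicit Types x z : 'rV[R]_d.

Definition lexpv x : R := \prod_i expR (- `|x 0 i|).
Definition poissonv z : R := \prod_i poisson (z 0 i).

Lemma expi_sum (I : Type) (r : seq I) (F : I -> R) :
  expi (\sum_(i <- r) F i) = \prod_(i <- r) expi (F i).
Proof.
elim: r => [|i r IH]; first by rewrite !big_nil expi0.
by rewrite !big_cons expiD IH.
Qed.

Lemma cintegrable_lexpv z :
  cintegrable leb (fun t => (lexpv (vec t))%:C%C * expi (- dot (vec t) z)) /\
  cintegral leb (fun t => (lexpv (vec t))%:C%C * expi (- dot (vec t) z)) =
  (poissonv z)%:C%C.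
Proof.
pose G (i : 'I_d) (x : R) : R[i] := (expR (- `|x|))%:C%C * expi (- (x * z 0 i)).
have -> : (fun t : T => (lexpv (vec t))%:C%C * expi (- dot (vec t) z)) =
    (fun t => \prod_i G i (tnth t i)).
  apply/funext => t; rewrite /lexpv rmorph_prod /dot -sumrN expi_sum -big_split/=.
  by apply: eq_bigr => i _; rewrite /G mxE.
have [Gi GE] := @cintegral_prod R d G (fun i => cintegrable_lexp _).
split => //; rewrite GE /poissonv rmorph_prod/=.
by apply: eq_bigr => i _; exact: fourier_lexp.
Qed.

Lemma integrable_poissonv : leb.-integrable setT (EFin \o (fun t => poissonv (vec t))) /\
  \int[leb]_t poissonv (vec t) = (2 * pi) ^+ d.
Proof.
have [] := @cintegral_prod R d (fun _ (s : R) => (poisson s)%:C%C)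
  (fun i => cintegrable_real (integrable_poisson R)).
have -> : (fun t : T => \prod_(i < d) (poisson (tnth t i))%:C%C) =
    (fun t => (poissonv (vec t))%:C%C).
  apply/funext => t; rewrite /poissonv rmorph_prod; apply: eq_bigr => i _.
  by rewrite mxE.
move=> [pi1 _]; split; first exact: pi1.
move: b; rewrite cintegral_real.
under [in X in _ = X -> _]eq_bigr => i _ do rewrite cintegral_real.
rewrite /Rintegral integral_poisson /= -rmorph_prod big_const card_ord iter_mulr_1.
by move=> /(congr1 (@complex.Re R)).
Qed.

Lemma poissonv_ge0 z : 0 <= poissonv z.
Proof. by apply: prodr_ge0 => i _; exact: poisson_ge0. Qed.

Lemma lexpv_ge0 x : 0 <= lexpv x.
Proof. by apply: prodr_ge0 => i _; exact: expR_ge0. Qed.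

Lemma lexpv_le1 x : lexpv x <= 1.
Proof.
suff /andP[] : 0 <= lexpv x <= 1 by [].
apply: (big_ind (fun y : R => 0 <= y <= 1)); first by rewrite ler01 lexx.
  by move=> y y' /andP[? ?] /andP[? ?]; rewrite mulr_ge0//= mulr_ile1.
by move=> i _; rewrite expR_ge0/= -expR0 ler_expR oppr_le0 normr_ge0.
Qed.

Lemma integrable_lexpv : leb.-integrable setT (EFin \o (fun t => lexpv (vec t))).
Proof.
have [li _] := cintegrable_lexpv 0.
have E (t : T) : normc ((lexpv (vec t))%:C%C * expi (- dot (vec t) 0)) = lexpv (vec t).
  rewrite ComplexField.Normc.normcM normc_expi mulr1 normc_sqrt/= expr0n/= addr0 sqrtr_sqr.
  by rewrite ger0_norm// lexpv_ge0.
by have := cintegrable_normc li; apply: eq_integrable => // t _; rewrite /comp E.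
Qed.

End poisson_vec.

(** * Fourier transforms of compactly supported functions *)

Section fourier_analysis.
Variables (R : realType) (d : nat).
Local Notation T := (d.-tuple (measurableTypeR R)).
Local Notation leb := (lebesgue_tuple R d).
Implicit Types (x y xi eta : 'rV[R]_d) (f chi : 'rV[R]_d -> R[i]).

Lemma dotC x y : dot x y = dot y x.
Proof. by apply: eq_bigr => i _; rewrite mulrC. Qed.

Lemma dotDl x y xi : dot (x + y) xi = dot x xi + dot y xi.
Proof. by rewrite /dot -big_split/=; apply: eq_bigr => i _; rewrite mxE mulrDl. Qed.

Lemma dotZl (a : R) x xi : dot (a *: x) xi = a * dot x xi.
Proof. by rewrite /dot mulr_sumr; apply: eq_bigr => i _; rewrite mxE mulrA. Qed.

Lemma dotDr x y xi : dot xi (x + y) = dot xi x + dot xi y.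
Proof. by rewrite ![dot xi _]dotC dotDl. Qed.

Lemma dotZr (a : R) x xi : dot xi (a *: x) = a * dot xi x.
Proof. by rewrite ![dot xi _]dotC dotZl. Qed.

Lemma dotNr x xi : dot xi (- x) = - dot xi x.
Proof. by rewrite -scaleN1r dotZr mulN1r. Qed.

Lemma dotNl x xi : dot (- x) xi = - dot x xi.
Proof. by rewrite -scaleN1r dotZl mulN1r. Qed.

Lemma measurable_vec_coord (d' : measure_display) (T' : measurableType d') (h : T' -> T) i :
  measurable_fun setT h -> measurable_fun setT (fun t => vec (h t) 0 i).
Proof. by move=> mh; exact: (measurableT_comp (@measurable_coord R d i) mh). Qed.

Lemma measurable_dot (d' : measure_display) (T' : measurableType d') (u v : T' -> 'rV[R]_d) :
  (forall i, measurable_fun setT (fun t => u t 0 i)) ->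
  (forall i, measurable_fun setT (fun t => v t 0 i)) ->
  measurable_fun setT (fun t => dot (u t) (v t)).
Proof.
by move=> mu mv; apply: measurable_sum => i; exact: measurable_funM.
Qed.

Definition compactly_supported f := ccontinuous f /\ compact (supp f).

(** On the bounded support of f the function poissonv is bounded below, by a
    power of 2 / (1 + B ^+ 2) if B bounds the support. This makes f integrable
    by comparison with poissonv. *)
Lemma compactly_supported_bound f : compactly_supported f ->
  exists M : R, 0 <= M /\ forall x, normc (f x) <= M * poissonv x.
Proof.
move=> [[cf1 cf2] sf].
have bnd (u : 'rV[R]_d -> R) : continuous u -> exists2 B : R, 0 <= B & forall x, supp f x -> `|u x| <= B.
  move=> cu.
  have : compact (u @` supp f).
    by apply: continuous_compact => //; exact: continuous_subspaceT.
  move=> /compact_bounded [B [_ /(_ (`|B| + 1))]].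
  rewrite (le_lt_trans (ler_norm B)) ?ltrDl// => /(_ isT) h.
  by exists (`|B| + 1) => // x sx; apply: h; exists x.
have [B1 B10 f1] := bnd _ cf1; have [B2 B20 f2] := bnd _ cf2.
have [B B0 fB] : exists2 B : R, 0 <= B & forall x, supp f x -> `|x| <= B.
  have [B [_ /(_ (`|B| + 1))]] := compact_bounded sf.
  rewrite (le_lt_trans (ler_norm B)) ?ltrDl// => /(_ isT) h.
  by exists (`|B| + 1).
pose p : R := 2 / (1 + B ^+ 2).
have p0 : 0 < p by rewrite divr_gt0// ltr_pwDl// sqr_ge0.
exists ((B1 + B2) / p ^+ d); split.
  by rewrite divr_ge0 ?addr_ge0// exprn_ge0// ltW.
move=> x; have [sx|nsx] := pselect (supp f x); last first.
  have -> : f x = 0.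
    apply: contrapT => fx; apply: nsx; apply: subset_closure => /=; exact/eqP.
  rewrite ComplexField.Normc.normc0 mulr_ge0 ?poissonv_ge0//.
  by rewrite divr_ge0 ?addr_ge0// exprn_ge0// ltW.
rewrite (le_trans (normc_le _))// (le_trans (lerD (f1 _ sx) (f2 _ sx)))//.
rewrite -mulrA ler_peMr ?addr_ge0// ler_pdivlMl ?exprn_gt0// mulr1.
rewrite -[in leLHS](card_ord d) -prodr_const; apply: ler_prod => i _.
rewrite (ltW p0)/= /p /poisson ler_pM2l// lef_pV2 ?posrE ?ltr_pwDl ?sqr_ge0//.
rewrite lerD2l -[leLHS]real_normK ?num_real// lerXn2r ?nnegrE//.
apply: le_trans (fB x sx).
by rewrite [leRHS]mx_normrE; apply: (le_bigmax _ _ (ord0, i)).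
Qed.

Lemma compactly_supported_bounded f : compactly_supported f ->
  exists M : R, forall x, normc (f x) <= M.
Proof.
move=> /compactly_supported_bound[M [M0 fM]]; exists (M * 2 ^+ d) => x.
rewrite (le_trans (fM x))// ler_wpM2l// -[in leRHS](card_ord d) -prodr_const.
apply: ler_prod => i _; rewrite poisson_ge0/= /poisson ler_pdivrMr ?ltr_pwDl ?sqr_ge0//.
by rewrite ler_peMr// lerDl sqr_ge0.
Qed.

Lemma cmeasurable_compactly_supported f : compactly_supported f ->
  cmeasurable (fun t : T => f (vec t)).
Proof. by move=> [cf _]; exact: cmeasurable_ccontinuous. Qed.

Lemma cintegrable_compactly_supported f : compactly_supported f ->
  cintegrable leb (fun t => f (vec t)).
Proof.
move=> cf; have [M [_ fM]] := compactly_supported_bound cf.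
apply: (cintegrable_le (u := fun t => M * poissonv (vec t))).
- exact: cmeasurable_compactly_supported.
- by apply: integrableZl_EFin; exact: (integrable_poissonv R d).1.
- by move=> t; exact: fM.
Qed.

Lemma fourierE f xi :
  fourier f xi = cintegral leb (fun t => f (vec t) * expi (- dot (vec t) xi)).
Proof. by []. Qed.

Lemma cintegrable_expi (g : T -> R[i]) (u : T -> R) : cintegrable leb g ->
  measurable_fun setT u -> cintegrable leb (fun t => g t * expi (u t)).
Proof.
move=> gi mu; apply: (cintegrableM (M := 1)) => //; first exact: measurable_expi.
by move=> t; rewrite normc_expi.
Qed.

Lemma measurable_dot_vec xi : measurable_fun setT (fun t : T => dot (vec t) xi).
Proof.
apply: (@measurable_dot _ _ (fun t : T => vec t) (fun=> xi)) => i //.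
exact: (measurable_vec_coord i (@measurable_id _ _ _)).
Qed.

Lemma measurable_dot_vec2 : measurable_fun setT (fun z : T * T => dot (vec z.1) (vec z.2)).
Proof.
apply: (@measurable_dot _ _ (fun z : T * T => vec z.1) (fun z => vec z.2)) => i.
  exact: (measurable_vec_coord i measurable_fst).
exact: (measurable_vec_coord i measurable_snd).
Qed.

Lemma cmeasurable_fourier f : compactly_supported f ->
  cmeasurable (fun t : T => fourier f (vec t)).
Proof.
move=> cf.
apply: (@cmeasurable_cintegral _ _ _ _ R leb
  (fun z => f (vec z.2) * expi (- dot (vec z.2) (vec z.1)))).
apply: cmeasurableM.
  apply: (cmeasurable_comp (cmeasurable_compactly_supported cf)).
  exact: measurable_snd.
apply: measurable_expi; apply: measurable_funN.
under [X in measurable_fun _ X]funext => z do rewrite dotC.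
exact: measurable_dot_vec2.
Qed.

End fourier_analysis.

(** * Fourier inversion and the transform of a product *)

Section fourier_inversion.
Variables (R : realType) (d : nat).
Local Notation T := (d.-tuple (measurableTypeR R)).
Local Notation leb := (lebesgue_tuple R d).
Implicit Types (x y xi eta : 'rV[R]_d) (f chi : 'rV[R]_d -> R[i]).

Lemma ReZ (a : R) (z : R[i]) : Re (a%:C%C * z) = a * Re z.
Proof. by rewrite complex_ReM/= mul0r subr0. Qed.

Lemma ImZ (a : R) (z : R[i]) : Im (a%:C%C * z) = a * Im z.
Proof. by rewrite complex_ImM/= mul0r addr0. Qed.

Lemma normcZ (a : R) (z : R[i]) : 0 <= a -> normc (a%:C%C * z) = a * normc z.
Proof.
move=> a0; rewrite ComplexField.Normc.normcM; congr (_ * _).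
by rewrite normc_sqrt/= expr0n/= addr0 sqrtr_sqr ger0_norm.
Qed.

Lemma cmeasurable_affine (f : 'rV[R]_d -> R[i]) (a : R) (b : 'rV[R]_d) :
  cmeasurable (fun t : T => f (vec t)) -> cmeasurable (fun t : T => f (a *: vec t + b)).
Proof.
move=> mf; under [X in cmeasurable X]funext => t do rewrite -vec_affine_tuple.
by apply: (cmeasurable_comp mf); exact: measurable_affine_tuple.
Qed.

Lemma cintegrable_poissonvM f x (a : R) : compactly_supported f ->
  cintegrable leb (fun t => (poissonv (vec t))%:C%C * f (x + a *: vec t)).
Proof.
move=> cf; have [M fM] := compactly_supported_bounded cf.
apply: cintegrableM (cintegrable_real (integrable_poissonv R d).1) _ (fun t => fM _).
under [X in cmeasurable X]funext => t do rewrite addrC.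
exact/cmeasurable_affine/cmeasurable_compactly_supported.
Qed.

(** Fubini turns the regularized inverse transform of the transform into the
    convolution of f with a dilated Poisson kernel; the substitution
    y = x + a z then moves the dilation into the argument of f. *)
Lemma regularized_inversion f x (a : R) : 0 < a -> compactly_supported f ->
  cintegral leb (fun t => (lexpv (a *: vec t))%:C%C *
    (fourier f (vec t) * expi (dot x (vec t)))) =
  cintegral leb (fun t => (poissonv (vec t))%:C%C * f (x + a *: vec t)).
Proof.
move=> a0 cf; have fi := cintegrable_compactly_supported cf.
have an0 : a != 0 by rewrite gt_eqF.
have affa (t : T) : vec (affine_tuple a 0 t) = a *: vec t.
  by rewrite vec_affine_tuple addr0.
have li : cintegrable leb (fun t => (lexpv (a *: vec t))%:C%C).
  have := cintegrable_affine 0 a0 (cintegrable_real (integrable_lexpv R d)).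
  by under [X in cintegrable _ X -> _]funext => t do rewrite affa.
transitivity (cintegral leb (fun s => cintegral leb (fun t =>
    (lexpv (a *: vec s))%:C%C * f (vec t) * expi (dot x (vec s) - dot (vec t) (vec s))))).
  congr cintegral; apply/funext => s.
  have -> : (fun t => (lexpv (a *: vec s))%:C%C * f (vec t) *
      expi (dot x (vec s) - dot (vec t) (vec s))) =
    (fun t => ((lexpv (a *: vec s))%:C%C * expi (dot x (vec s))) *
      (f (vec t) * expi (- dot (vec t) (vec s)))).
    by apply/funext => t; rewrite expiD; ring.
  rewrite cintegralZl -?fourierE; first by ring.
  by apply: cintegrable_expi => //; apply: measurable_funN; exact: measurable_dot_vec.
rewrite (@cintegral_fubini _ _ _ _ R leb leb (fun s => (lexpv (a *: vec s))%:C%C)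
  (fun t => f (vec t))
  (fun z => expi (dot x (vec z.1) - dot (vec z.2) (vec z.1)))) //; last 2 first.
- apply: measurable_expi; apply: measurable_funB.
    under [X in measurable_fun _ X]funext => z do rewrite dotC.
    by apply: (measurableT_comp (measurable_dot_vec x)); exact: measurable_fst.
  under [X in measurable_fun _ X]funext => z do rewrite dotC.
  exact: measurable_dot_vec2.
- by move=> z; rewrite normc_expi.
pose H z := (poissonv z)%:C%C * f (x + a *: z).
have Hi : cintegrable leb (fun t => H (vec t)) by exact: cintegrable_poissonvM.
transitivity (cintegral leb (fun t => (a ^- d)%:C%C * H (vec (affine_tuple a^-1 (- a^-1 *: x) t)))).
  congr cintegral; apply/funext => t.
  rewrite vec_affine_tuple /H.
  pose y := a^-1 *: vec t + - a^-1 *: x.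
  have ay : x + a *: y = vec t.
    by rewrite /y scalerDr !scalerA mulrN mulfV// scale1r scaleN1r addrCA subrr addr0.
  rewrite -/y ay.
  have [lyi lyE] := cintegrable_lexpv (y : 'rV[R]_d).
  have := cintegral_affine (0 : 'rV[R]_d) a0 lyi; rewrite lyE => E.
  rewrite mulrA -E mulrC -cintegralZl; last exact: (cintegrable_affine 0 a0 lyi).
  congr cintegral; apply/funext => s; rewrite affa -[in LHS]ay dotDl !dotZl.
  rewrite (_ : dot x (vec s) - _ = - (a * dot (vec s) y)); last first.
    by rewrite opprD addNKr dotC.
  by rewrite ay mulrCA mulrA.
rewrite cintegralZl; last by apply: (cintegrable_affine (- a^-1 *: x) _ Hi); rewrite invr_gt0.
rewrite (@cintegral_affine R d a^-1 _ (fun t => H (vec t))) ?invr_gt0// mulrA.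
rewrite -rmorphM/= exprVn invrK mulVf ?mul1r//.
by rewrite expf_neq0.
Qed.
End fourier_inversion.

Section fourier_convolution.
Variables (R : realType) (d : nat).
Local Notation T := (d.-tuple (measurableTypeR R)).
Local Notation leb := (lebesgue_tuple R d).
Implicit Types (x y xi eta : 'rV[R]_d) (f chi : 'rV[R]_d -> R[i]).

Lemma lexpvZ (a : R) x : 0 <= a ->
  lexpv (a *: x) = expR (- (a * \sum_i `|x 0 i|)).
Proof.
move=> a0; rewrite mulr_sumr -sumrN.
rewrite (big_morph expR (@expRD R) (@expR0 R)); apply: eq_bigr => i _.
by rewrite mxE normrM ger0_norm.
Qed.

Lemma cvg_lexpvZ x : lexpv (n.+1%:R^-1 *: x) @[n --> \oo] --> (1 : R).
Proof.
have -> : (fun n : nat => lexpv (n.+1%:R^-1 *: x)) =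
    (fun n => expR (- (n.+1%:R^-1 * \sum_i `|x 0 i|))).
  by apply/funext => n; rewrite lexpvZ// invr_ge0.
have lim0 : - (n.+1%:R^-1 * \sum_i `|x 0 i|) @[n --> \oo] --> (0 : R).
  move: (\sum_i _) => S; rewrite -oppr0; apply: cvgN; rewrite -(mul0r S).
  by apply: cvgMr_tmp; exact: (@cvg_harmonic R).
have := cvg_comp _ _ lim0 (@continuous_expR R 0).
by rewrite expR0.
Qed.

Lemma cvg_lexpvZM x (c : R) : lexpv (n.+1%:R^-1 *: x) * c @[n --> \oo] --> c.
Proof. by rewrite -{2}(mul1r c); apply: cvgMr_tmp; exact: cvg_lexpvZ. Qed.

Lemma cvg_shrink x y (u : 'rV[R]_d -> R) : continuous u ->
  u (x + n.+1%:R^-1 *: y) @[n --> \oo] --> u x.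
Proof.
move=> cu.
have h : n.+1%:R^-1 *: y @[n --> \oo] --> (0 : 'rV[R]_d).
  by rewrite -(scale0r y); apply: cvgZr_tmp; exact: (@cvg_harmonic R).
have h' : x + n.+1%:R^-1 *: y @[n --> \oo] --> x.
  have := cvgD (@cvg_cst _ x nat \oo _) h. rewrite addr0; exact.
exact: (cvg_comp _ _ h' (cu x)).
Qed.

(** Both sides of [regularized_inversion] converge as a -> 0, by
    dominated convergence: the left one because the transform of f is assumed
    integrable, the right one because f is bounded and poissonv
    integrable. *)
Lemma fourier_inversion f x : compactly_supported f ->
  cintegrable leb (fun t => fourier f (vec t)) ->
  cintegral leb (fun t => fourier f (vec t) * expi (dot x (vec t))) =
  ((2 * pi) ^+ d)%:C%C * f x.
Proof.
move=> cf Fi; have [[cf1 cf2] _] := cf.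
have a0 n : 0 < n.+1%:R^-1 :> R by rewrite invr_gt0.
have mdot : measurable_fun setT (fun t : T => dot x (vec t)).
  under [X in measurable_fun _ X]funext => t do rewrite dotC.
  exact: measurable_dot_vec.
have mFe : cmeasurable (fun t : T => fourier f (vec t) * expi (dot x (vec t))).
  by apply: cmeasurableM; [exact: cmeasurable_fourier|exact: measurable_expi].
have [M fM] := compactly_supported_bounded cf.
have mP : cmeasurable (fun t : T => (poissonv (vec t))%:C%C).
  exact: cintegrable_measurable (cintegrable_real (integrable_poissonv R d).1).
have mL n : cmeasurable (fun t : T => (lexpv (n.+1%:R^-1 *: vec t))%:C%C).
  have := cintegrable_measurable (cintegrable_real (integrable_lexpv R d)).
  move=> /(@cmeasurable_affine R d (fun x => (lexpv x)%:C%C) n.+1%:R^-1 0).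
  by under [X in cmeasurable X -> _]funext => t do rewrite addr0.
have [L1 L2] : Re (cintegral leb (fun t => (lexpv (n.+1%:R^-1 *: vec t))%:C%C *
        (fourier f (vec t) * expi (dot x (vec t))))) @[n --> \oo] -->
      Re (cintegral leb (fun t => fourier f (vec t) * expi (dot x (vec t)))) /\
    Im (cintegral leb (fun t => (lexpv (n.+1%:R^-1 *: vec t))%:C%C *
        (fourier f (vec t) * expi (dot x (vec t))))) @[n --> \oo] -->
      Im (cintegral leb (fun t => fourier f (vec t) * expi (dot x (vec t)))).
  apply: cvg_cintegral (cintegrable_normc Fi) _ _ _ => //.
  - by move=> n; exact: cmeasurableM.
  - move=> n t; rewrite normcZ ?lexpv_ge0// ComplexField.Normc.normcM normc_expi mulr1.
    by rewrite ler_piMl ?normc_ge0 ?lexpv_le1.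
  - by move=> t; under [X in X @ _]funext => n do rewrite ReZ; exact: cvg_lexpvZM.
  - by move=> t; under [X in X @ _]funext => n do rewrite ImZ; exact: cvg_lexpvZM.
have [P1 P2] : Re (cintegral leb (fun t => (poissonv (vec t))%:C%C *
        f (x + n.+1%:R^-1 *: vec t))) @[n --> \oo] -->
      Re (cintegral leb (fun t => (poissonv (vec t))%:C%C * f x)) /\
    Im (cintegral leb (fun t => (poissonv (vec t))%:C%C *
        f (x + n.+1%:R^-1 *: vec t))) @[n --> \oo] -->
      Im (cintegral leb (fun t => (poissonv (vec t))%:C%C * f x)).
  apply: cvg_cintegral (integrableZl_EFin M (integrable_poissonv R d).1) _ _ _.
  - by move=> n; apply: cintegrable_measurable; exact: cintegrable_poissonvM.
  - by apply: cmeasurableM => //; exact: cmeasurable_cst.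
  - by move=> n t; rewrite normcZ ?poissonv_ge0// mulrC ler_wpM2r ?poissonv_ge0.
  - move=> t; under [X in X @ _]funext => n do rewrite ReZ.
    by rewrite ReZ; apply: cvgMl_tmp; exact: cvg_shrink cf1.
  - move=> t; under [X in X @ _]funext => n do rewrite ImZ.
    by rewrite ImZ; apply: cvgMl_tmp; exact: cvg_shrink cf2.
have -> : ((2 * pi) ^+ d)%:C%C * f x =
    cintegral leb (fun t => (poissonv (vec t))%:C%C * f x).
  under [X in cintegral _ X]funext => t do rewrite mulrC.
  rewrite cintegralZl; last exact: cintegrable_real (integrable_poissonv R d).1.
  by rewrite cintegral_real (integrable_poissonv R d).2 mulrC.
apply: complexP.
- apply: (cvg_unique _ L1) => //.
  by under [X in X @ _]funext => n do rewrite regularized_inversion//.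
- apply: (cvg_unique _ L2) => //.
  by under [X in X @ _]funext => n do rewrite regularized_inversion//.
Qed.


(** Replace chi by its inverse transform in the transform of chi * f, and
    exchange the two integrals. *)
Lemma fourier_mul chi f xi : compactly_supported chi -> compactly_supported f ->
  cintegrable leb (fun t => fourier chi (vec t)) ->
  ((2 * pi) ^+ d)%:C%C * fourier (chi \* f) xi =
  cintegral leb (fun t => fourier chi (vec t) * fourier f (xi - vec t)).
Proof.
move=> cchi cf Fi; have fi := cintegrable_compactly_supported cf.
have mdot x : measurable_fun setT (fun t : T => dot x (vec t)).
  under [X in measurable_fun _ X]funext => t do rewrite dotC.
  exact: measurable_dot_vec.
have mN (u : T -> R) : measurable_fun setT u -> measurable_fun setT (fun t => - u t).
  by move=> ?; exact: measurable_funN.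
transitivity (cintegral leb (fun s => cintegral leb (fun t =>
    fourier chi (vec s) * f (vec t) * expi (dot (vec t) (vec s) - dot (vec t) xi)))).
  rewrite (@cintegral_fubini _ _ _ _ R leb leb (fun s => fourier chi (vec s))
    (fun t => f (vec t)) (fun z => expi (dot (vec z.2) (vec z.1) - dot (vec z.2) xi))) //.
  - rewrite fourierE -cintegralZl; last first.
      apply: cintegrable_expi; last by apply: mN; exact: measurable_dot_vec.
      have [M chiM] := compactly_supported_bounded cchi.
      have := cintegrableM fi (cmeasurable_compactly_supported cchi) (fun t => chiM _).
      by under [X in cintegrable _ X -> _]funext => t do rewrite mulrC.
    congr cintegral; apply/funext => t /=.
    rewrite (_ : _ * _ = (f (vec t) * expi (- dot (vec t) xi)) *
      (((2 * pi) ^+ d)%:C%C * chi (vec t))); last by ring.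
    rewrite -(fourier_inversion _ cchi Fi) -cintegralZl; last exact: cintegrable_expi.
    by congr cintegral; apply/funext => s; rewrite expiD; ring.
  - apply: measurable_expi; apply: measurable_funB.
      under [X in measurable_fun _ X]funext => z do rewrite dotC.
      exact: measurable_dot_vec2.
    by apply: (measurableT_comp (measurable_dot_vec xi)); exact: measurable_snd.
  - by move=> z; rewrite normc_expi.
congr cintegral; apply/funext => s.
rewrite [fourier f _]fourierE -cintegralZl; last first.
  apply: cintegrable_expi => //; by apply: mN; exact: measurable_dot_vec.
congr cintegral; apply/funext => t; rewrite mulrA; congr (_ * expi _).
by rewrite dotDr dotNr opprD opprK addrC.
Qed.

End fourier_convolution.

(** * Submultiplicativity of weighted norms *)

Section fourier_submultiplicativity.
Variables (R : realType) (d : nat).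
Local Notation T := (d.-tuple (measurableTypeR R)).
Local Notation leb := (lebesgue_tuple R d).
Implicit Types (x y xi eta : 'rV[R]_d) (f chi : 'rV[R]_d -> R[i]).

Definition sub_tuple (z : T * T) : T := [tuple tnth z.1 i - tnth z.2 i | i < d].

Lemma vec_sub_tuple z : vec (sub_tuple z) = vec z.1 - vec z.2.
Proof. by apply/rowP => i; rewrite !mxE tnth_mktuple. Qed.

Lemma measurable_sub_tuple : measurable_fun setT sub_tuple.
Proof.
apply/measurable_fun_tnthP => i.
rewrite (_ : _ \o _ = fun z : T * T => tnth z.1 i - tnth z.2 i).
  apply: measurable_funB.
    by apply: (measurableT_comp (measurable_tnth i)); exact: measurable_fst.
  by apply: (measurableT_comp (measurable_tnth i)); exact: measurable_snd.
by apply/funext => z /=; rewrite tnth_mktuple.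
Qed.

(** The weight W is distributed over the two factors of the
    convolution; Tonelli and a translation separate the integrals. *)
Lemma wnorm_mul_le (W : 'rV[R]_d -> R) chi f :
  (forall x, 0 <= W x) -> measurable_fun setT (fun t : T => W (vec t)) ->
  (forall x y, W (x + y) <= W x * W y) ->
  compactly_supported chi -> compactly_supported f ->
  cintegrable leb (fun t => fourier chi (vec t)) ->
  (eint (fun xi => (normc (fourier (chi \* f) xi) * W xi)%:E) <=
   (2 / (2 * pi) ^+ d)%:E * (eint (fun xi => (normc (fourier chi xi) * W xi)%:E) *
                             eint (fun xi => (normc (fourier f xi) * W xi)%:E)))%E.
Proof.
move=> W0 mW WM cchi cf Fi.
pose c : R := (2 * pi) ^+ d.
have c0 : 0 < c by rewrite exprn_gt0// mulr_gt0// pi_gt0.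
have k0 : 0 <= 2 / c by rewrite divr_ge0// ltW.
pose A g xi : R := normc (fourier g xi) * W xi.
have A0 g xi : 0 <= A g xi by rewrite mulr_ge0// normc_ge0.
have mA g : compactly_supported g -> measurable_fun setT (fun t : T => A g (vec t)).
  move=> cg; apply: measurable_funM => //.
  exact: measurable_normc (cmeasurable_fourier cg).
have mA2 : measurable_fun setT (fun z : T * T => A f (vec z.1 - vec z.2)).
  under [X in measurable_fun _ X]funext => z do rewrite -vec_sub_tuple.
  exact: (measurableT_comp (mA f cf) measurable_sub_tuple).
have mAA : measurable_fun setT (fun z : T * T => (A chi (vec z.2) * A f (vec z.1 - vec z.2))%:E).
  apply/measurable_EFinP; apply: measurable_funM => //.
  by apply: (measurableT_comp (mA chi cchi)); exact: measurable_snd.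
have AA0 (z : T * T) : (0 <= (A chi (vec z.2) * A f (vec z.1 - vec z.2))%:E)%E.
  by rewrite lee_fin mulr_ge0.
have mchif : cmeasurable (fun t : T => fourier (chi \* f) (vec t)).
  have : cmeasurable (fun t : T => (c^-1)%:C%C * (c%:C%C * fourier (chi \* f) (vec t))).
    apply: cmeasurableM; first exact: cmeasurable_cst.
    under [X in cmeasurable X]funext => t do rewrite fourier_mul//.
    apply: (@cmeasurable_cintegral _ _ _ _ R leb
      (fun z => fourier chi (vec z.2) * fourier f (vec z.1 - vec z.2))).
    apply: cmeasurableM.
      by apply: (cmeasurable_comp (cmeasurable_fourier cchi)); exact: measurable_snd.
    under [X in cmeasurable X]funext => z do rewrite -vec_sub_tuple.
    by apply: (cmeasurable_comp (cmeasurable_fourier cf)); exact: measurable_sub_tuple.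
  by under [X in cmeasurable X -> _]funext => t do
    rewrite mulrA -rmorphM/= mulVf ?gt_eqF// mul1r.
have pointwise (s : T) : ((A (chi \* f) (vec s))%:E <=
    (2 / c)%:E * \int[leb]_t (A chi (vec t) * A f (vec s - vec t))%:E)%E.
  have mfs : cmeasurable (fun t : T => fourier f (vec s - vec t)).
    under [X in cmeasurable X]funext => t do rewrite -(vec_sub_tuple (s, t)).
    apply: (cmeasurable_comp (cmeasurable_fourier cf)).
    exact: (measurableT_comp measurable_sub_tuple (pair1_measurable s)).
  have := le_normc_cintegral leb (cmeasurableM (cmeasurable_fourier cchi) mfs).
  rewrite -fourier_mul// normcZ; last exact: ltW.
  rewrite -/c => le2.
  have mAs : measurable_fun setT (fun t : T => (A chi (vec t) * A f (vec s - vec t))%:E).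
    exact: (measurableT_comp mAA (pair1_measurable s)).
  have mns : measurable_fun setT (fun t : T =>
      (normc (fourier chi (vec t) * fourier f (vec s - vec t)))%:E).
    apply/measurable_EFinP.
    exact: measurable_normc (cmeasurableM (cmeasurable_fourier cchi) mfs).
  have -> : (2 / c)%:E = ((c^-1)%:E * 2%:E)%E by rewrite mulrC.
  rewrite -muleA lee_pdivlMl// -EFinM /A mulrA EFinM.
  apply: (le_trans (lee_wpmul2r _ le2)); first by rewrite lee_fin.
  rewrite -muleA lee_pmul2l// -ge0_integralZr//; last 2 first.
  - by move=> t _; rewrite lee_fin normc_ge0.
  - by rewrite lee_fin.
  apply: ge0_le_integral => //.
  - by move=> t _; rewrite -EFinM lee_fin mulr_ge0// normc_ge0.
  - by apply: emeasurable_funM => //; exact: measurable_cst.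
  - move=> t _; rewrite -EFinM lee_fin ComplexField.Normc.normcM mulrACA.
    rewrite ler_wpM2l ?mulr_ge0 ?normc_ge0//.
    by rewrite -[X in W X <= _](subrK (vec t)) [leRHS]mulrC; exact: WM.
rewrite /eint -/(A _ _).
apply: (@le_trans _ _ (\int[leb]_s ((2 / c)%:E *
    \int[leb]_t (A chi (vec t) * A f (vec s - vec t))%:E))%E).
  apply: ge0_le_integral => //.
  - by move=> s _; rewrite lee_fin A0.
  - apply/measurable_EFinP; apply: measurable_funM => //; exact: measurable_normc.
  - apply: measurable_funeM.
    exact: (measurable_fun_fubini_tonelli_F (m2 := leb) _ mAA AA0).
  - by move=> s _; exact: pointwise.
rewrite ge0_integralZl//; last 2 first.
- exact: (measurable_fun_fubini_tonelli_F (m2 := leb) _ mAA AA0).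
- by move=> s _; apply: integral_ge0 => t _; exact: (AA0 (s, t)).
rewrite lee_wpmul2l ?lee_fin//.
rewrite (fubini_tonelli (m1 := leb) (m2 := leb)
  (fun z : T * T => (A chi (vec z.2) * A f (vec z.1 - vec z.2))%:E))//.
have trans t : (\int[leb]_s (A f (vec s - vec t))%:E = \int[leb]_s (A f (vec s))%:E)%E.
  have := ge0_integral_affine (- vec t) ltr01 (F := fun s => (A f (vec s))%:E).
  rewrite expr1n invr1 mul1e => <-; last 2 first.
    by apply/measurable_EFinP; exact: mA.
    by move=> s; rewrite lee_fin.
  by apply: eq_integral => s _; rewrite vec_affine_tuple scale1r.
have E t : (\int[leb]_s (A chi (vec t) * A f (vec s - vec t))%:E =
    (A chi (vec t))%:E * \int[leb]_s (A f (vec s))%:E)%E.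
  rewrite -(trans t); under eq_integral => s _ do rewrite EFinM.
  rewrite ge0_integralZl//.
  - by apply/measurable_EFinP; exact: (measurableT_comp mA2 (pair2_measurable t)).
  - by move=> s _; rewrite lee_fin.
  - by rewrite lee_fin.
under eq_integral => t _ do rewrite E.
rewrite ge0_integralZr//.
- by apply/measurable_EFinP; exact: mA.
- by move=> t _; rewrite lee_fin.
- by apply: integral_ge0 => t _; rewrite lee_fin.
Qed.

End fourier_submultiplicativity.

(** * Construction of weights *)

Section neighborhoods.
Variable R : realType.

Lemma near_pinftyP (P : R -> Prop) :
  (\forall t \near +oo, P t) <-> exists T : R, forall t, T <= t -> P t.
Proof.
split=> [[M [_ MP]]|[T TP]].
  by exists (M + 1) => t Mt; apply: MP; rewrite (lt_le_trans _ Mt)// ltrDl.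
by exists T; split; rewrite ?num_real// => t /ltW; exact: TP.
Qed.

Lemma near_0rightP (P : R -> Prop) :
  (\forall e \near 0^'+, P e) <-> exists2 dl : R, 0 < dl & forall e, 0 < e < dl -> P e.
Proof.
split=> [|[dl dl0 dlP]].
  move=> [dl /= dl0 dlP]; exists dl => // e /andP[e0 edl].
  by apply: dlP => //=; rewrite sub0r normrN gtr0_norm.
exists dl => //= e; rewrite /= sub0r normrN => edl e0.
by apply: dlP; rewrite e0/= -(gtr0_norm e0).
Qed.

Lemma dominatedP (w1 w2 : R -> R) : dominated w1 w2 <->
  forall c : R, 0 < c -> exists T : R, forall t, T <= t -> `|w1 t| <= c * `|w2 t|.
Proof. by split=> H c c0; have := H c c0; rewrite near_pinftyP. Qed.

End neighborhoods.

Section concave_envelope.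
Variables (R : realType) (C : nat -> R).
Hypotheses (C0 : C 0%N = 0) (Cge0 : forall n, 0 <= C n).

(** A concave function, as an infimum of affine ones. It is subadditive because
    the ordinates C n are nonnegative, and 1-Lipschitz on the whole line
    because all slopes are at most 1. *)
Definition envelope (x : R) : R := inf [set x / n.+1%:R + C n | n in [set: nat]].

Lemma envelope_has_lbound x : has_lbound [set x / n.+1%:R + C n | n in [set: nat]].
Proof.
exists (- `|x|) => _ [n _ <-]; rewrite -[leLHS]addr0 lerD//.
rewrite lerNl -mulNr ler_pdivrMr ?ltr0n// (le_trans (ler_norm _))// normrN.
by rewrite ler_peMr// ler1n.
Qed.

Lemma envelope_le n x : envelope x <= x / n.+1%:R + C n.
Proof. by apply: ge_inf; [exact: envelope_has_lbound|exists n]. Qed.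

Lemma le_envelope x m : (forall n, m <= x / n.+1%:R + C n) -> m <= envelope x.
Proof.
move=> mx; apply: lb_le_inf; first by exists (x / 1%:R + C 0%N); exists 0%N.
by move=> _ [n _ <-].
Qed.

Lemma envelope_ge0 x : 0 <= x -> 0 <= envelope x.
Proof. by move=> x0; apply: le_envelope => n; rewrite addr_ge0// divr_ge0. Qed.

Lemma envelope_le_id x : envelope x <= x.
Proof. by have := envelope_le 0 x; rewrite C0 addr0 divr1. Qed.

Lemma envelope_homo x y : x <= y -> envelope x <= envelope y.
Proof.
move=> xy; apply: le_envelope => n; rewrite (le_trans (envelope_le n x))// lerD2r.
by rewrite ler_pM2r// invr_gt0 ltr0n.
Qed.

Lemma envelope_lipschitz x y : envelope x <= envelope y + `|x - y|.
Proof.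
rewrite -lerBlDr; apply: le_envelope => n; rewrite lerBlDr.
rewrite (le_trans (envelope_le n x))// addrAC lerD2r -lerBlDl -mulrBl.
rewrite ler_pdivrMr ?ltr0n// (le_trans (ler_norm _))// ler_peMr// ler1n//.
Qed.

Lemma continuous_envelope : continuous envelope.
Proof.
move=> x; apply/cvgrPdist_le => e e0; near=> y.
have := envelope_lipschitz x y; have := envelope_lipschitz y x.
rewrite (distrC y x) => yx xy.
apply: (@le_trans _ _ `|x - y|).
  by rewrite ler_norml lerNl opprB !lerBlDl yx.
by near: y; apply: cvgr_dist_le.
Unshelve. all: by end_near. Qed.

(** Whichever lines n and m are evaluated at x and at y, the one of smaller
    slope takes at x + y a value below the sum of the two values. *)
Lemma envelopeD x y : 0 <= x -> 0 <= y ->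
  envelope (x + y) <= envelope x + envelope y.
Proof.
move=> x0 y0.
rewrite -lerBlDr; apply: le_envelope => n; rewrite lerBlDr -lerBlDl.
apply: le_envelope => m; rewrite lerBlDl.
have key (a b : nat) (s t : R) : 0 <= s -> (a <= b)%N ->
    (s + t) / b.+1%:R + C b <= s / a.+1%:R + C a + (t / b.+1%:R + C b).
  move=> s0 ab; rewrite mulrDl -addrA lerD2r.
  apply: (@le_trans _ _ (s / a.+1%:R)); last by rewrite lerDl.
  by rewrite ler_wpM2l// lef_pV2 ?posrE ?ltr0n// ler_nat ltnS.
have [nm|/ltnW mn] := leqP n m.
  exact: le_trans (envelope_le m _) (key _ _ _ _ x0 nm).
rewrite addrC [leRHS]addrC; exact: le_trans (envelope_le n _) (key _ _ _ _ y0 mn).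
Qed.

End concave_envelope.

Section weights.
Variable R : realType.
Implicit Types (w psi : R -> R).

Lemma weight_ln_dominated w : weight w -> dominated (fun t => ln (1 + t)) w.
Proof.
move=> [[w0 _ _ _] [_ _ wln]]; apply/dominatedP => c c0.
have [T TP] : exists T : R, forall t, T <= t -> c^-1 <= w t / ln (1 + t).
  by apply/near_pinftyP; move/cvgryPge : wln; exact.
exists (Num.max T 1) => t; rewrite ge_max => /andP[Tt t1].
have t0 : 0 <= t by rewrite (le_trans _ t1).
have ln0 : 0 < ln (1 + t) by rewrite ln_gt0// ltrDl (lt_le_trans _ t1).
rewrite (gtr0_norm ln0) ger0_norm ?w0//.
by have := TP _ Tt; rewrite ler_pdivlMr// ler_pdivrMl.
Qed.

Lemma weight_unbounded w : weight w -> forall M : R, exists T : R, forall t, T <= t -> M <= w t.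
Proof.
move=> ww M; have [[w0 _ _ _] _] := ww.
have /dominatedP/(_ _ ltr01)[T TP] := weight_ln_dominated ww.
exists (Num.max (Num.max T 0) (expR M)) => t; rewrite !ge_max => /andP[/andP[Tt t0] Mt].
have := TP _ Tt; rewrite mul1r (ger0_norm (w0 _ t0)); apply: le_trans.
rewrite (le_trans _ (ler_norm _))// -[leLHS]expRK ler_ln ?posrE ?expR_gt0//.
  by rewrite (le_trans Mt)// lerDr.
by rewrite ltr_pwDl.
Qed.

Lemma measurable_weight w : weight w -> measurable_fun (`[0%R, +oo[ : set R) w.
Proof.
by move=> [[_ _ cw _] _]; apply: subspace_continuous_measurable_fun.
Qed.

(** Apart from the growth condition, which is assumed, every axiom passes from
    w to its envelope; the integral condition because the envelope lies
    below w. *)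
Lemma weight_envelope w (C : nat -> R) : weight w ->
  C 0%N = 0 -> (forall n, 0 <= C n) ->
  dominated (fun t => ln (1 + t)) (envelope C \o w) -> weight (envelope C \o w).
Proof.
move=> ww C0 Cge0 lnF; have [[w0 wh cw w00] [wD wi _]] := ww.
have cF : {within `[0, +oo[, continuous (envelope C \o w)}.
  move=> x; have := @continuous_envelope R C Cge0 (w x).
  exact: (cvg_comp w (envelope C) (cw x)).
have sub1 : ([set` `[1%R, +oo[] : set R) `<=` [set` `[0%R, +oo[].
  by apply: subset_itvr; rewrite bnd_simp.
split; split => //.
- by move=> t t0; apply: envelope_ge0 => //; exact: w0.
- by move=> s t s0 st; apply: envelope_homo => //; exact: wh.
- by apply/eqP; rewrite eq_le envelope_ge0 ?w00// -[leRHS]w00 envelope_le_id.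
- move=> s t s0 t0; rewrite (le_trans (envelope_homo Cge0 (wD _ _ s0 t0)))//.
  by apply: envelopeD => //; exact: w0.
- have mdiv (v : R -> R) : measurable_fun (`[0%R, +oo[ : set R) v ->
      measurable_fun (`[1%R, +oo[ : set R) (fun t => (v t / t ^+ 2)%:E).
    move=> mv; apply/measurable_EFinP/measurable_funM.
      by apply: measurable_funS mv.
    apply: (@measurable_funS _ _ _ _ (`]0%R, +oo[ : set R)) => //.
      by apply: subset_itvr; rewrite bnd_simp.
    apply: open_continuous_measurable_fun; first exact: interval_open.
    move=> t; rewrite inE/= in_itv/= andbT => t0.
    apply: cvgV; first by rewrite gt_eqF// exprn_gt0.
    exact: exprn_continuous.
  apply: le_lt_trans wi; apply: ge0_le_integral => //=.
  + move=> t; rewrite in_itv/= andbT => t1.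
    rewrite lee_fin divr_ge0 ?sqr_ge0// envelope_ge0// w0//.
    exact: le_trans t1.
  + by apply: mdiv; exact: subspace_continuous_measurable_fun.
  + by apply: mdiv; exact: measurable_weight.
  + move=> t _; rewrite lee_fin ler_wpM2r ?invr_ge0 ?sqr_ge0//.
    exact: envelope_le_id.
- apply/cvgryPge => A; apply/near_pinftyP.
  have A1 : 0 < `|A| + 1 by rewrite ltr_wpDl.
  have A0 : 0 < (`|A| + 1)^-1 by rewrite invr_gt0.
  have /dominatedP/(_ _ A0)[T TP] := lnF.
  exists (Num.max T 1) => t; rewrite ge_max => /andP[Tt t1].
  have t0 : 0 <= t by rewrite (le_trans _ t1).
  have ln0 : 0 < ln (1 + t) by rewrite ln_gt0// ltrDl (lt_le_trans _ t1).
  have := TP _ Tt; rewrite (gtr0_norm ln0) (ger0_norm (envelope_ge0 Cge0 (w0 _ t0))).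
  rewrite ler_pdivlMl// => h; rewrite ler_pdivlMr//.
  by apply: le_trans h; rewrite ler_pM2r// (le_trans (ler_norm A))// lerDl.
Qed.

Lemma dominated_le w1 w : weight w1 -> weight w -> dominated w1 w ->
  forall h : R, 0 < h -> exists C : R, forall t, 0 <= t -> w1 t <= h * w t + C.
Proof.
move=> [[w10 w1h _ _] _] [[w0 _ _ _] _] /dominatedP w1w h h0.
have [T TP] := w1w _ h0; exists (w1 (Num.max T 0)) => t t0.
have [Tt|tT] := leP T t.
  have := TP _ Tt; rewrite !ger0_norm ?w10 ?w0// => h1.
  by rewrite (le_trans h1)// lerDl w10// le_max lexx orbT.
rewrite (@le_trans _ _ (w1 (Num.max T 0)))//.
  by rewrite w1h// le_max (ltW tT).
by rewrite lerDr mulr_ge0 ?w0// ltW.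
Qed.

(** The ordinate C n, for n > 0, is chosen so that (n + 1) * psi lies below the
    line n evaluated at w, beyond a bound T0 that does not depend on n.
    Given m, the lines of large index thus dominate m * psi beyond T0, and the
    finitely many others dominate it near infinity because psi << w. Adding ln (1 + t) to psi secures the growth condition on
    w2. *)
Lemma exists_weight_between w psi : weight w -> dominated psi w ->
  exists w2, [/\ weight w2, dominated w2 w & dominated psi w2].
Proof.
move=> ww psiw; have [[w0 wh _ _] _] := ww.
pose phi t := `|psi t| + `|ln (1 + t)|.
have phi0 t : 0 <= phi t by rewrite addr_ge0.
have phiw c : 0 < c -> exists T : R, 0 <= T /\ forall t, T <= t -> phi t <= c * w t.
  move=> c0; have c20 : 0 < c / 2 by rewrite divr_gt0.
  have [T1 T1P] := (dominatedP _ _).1 psiw _ c20.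
  have [T2 T2P] := (dominatedP _ _).1 (weight_ln_dominated ww) _ c20.
  exists (Num.max (Num.max T1 T2) 0); split; first by rewrite le_max lexx orbT.
  move=> t; rewrite !ge_max => /andP[/andP[t1 t2] t0].
  have := T1P _ t1; have := T2P _ t2; rewrite (ger0_norm (w0 _ t0)) /phi; lra.
have [T0 [T00 T0P]] := phiw 1 ltr01.
have pos (n : nat) : 0 < (n.+1%:R ^+ 2)^-1 :> R by rewrite invr_gt0 exprn_gt0.
have [T TP] := choice (fun n => phiw _ (pos n)).
pose C n : R := if n is 0%N then 0 else n.+1%:R * w (T n).
have Cge0 n : 0 <= C n.
  by case: n => [|n] //=; rewrite mulr_ge0// w0//; have [] := TP n.+1.
have envw t : 0 <= t -> 0 <= envelope C (w t) by move=> t0; rewrite envelope_ge0// w0.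
have phiF : dominated phi (envelope C \o w).
  apply/dominatedP => c c0.
  have [m mc] : exists m : nat, c^-1 <= m.+1%:R.
    by exists (Num.truncn c^-1); apply/ltW/truncnS_gt.
  have m0 : 0 < (m.+2%:R * m.+1%:R)^-1 :> R by rewrite invr_gt0 mulr_gt0.
  have [S [S0 SP]] := phiw _ m0.
  exists (Num.max S T0) => t; rewrite ge_max => /andP[St T0t].
  have t0 : 0 <= t by rewrite (le_trans _ T0t).
  rewrite (ger0_norm (phi0 t)) (ger0_norm (envw _ t0)) -ler_pdivrMl//.
  apply: (@le_trans _ _ (m.+1%:R * phi t)); first by rewrite ler_wpM2r.
  apply: le_envelope => n.
  have [nm|mn] := leqP n m.+1.
    apply: (@le_trans _ _ (w t / n.+1%:R)); last by rewrite lerDl.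
    apply: (@le_trans _ _ (w t / m.+2%:R)).
      rewrite ler_pdivlMr// mulrC mulrA -ler_pdivlMl ?mulr_gt0//.
      exact: SP.
    rewrite ler_wpM2l ?w0// lef_pV2 ?posrE ?ltr0n// ler_nat//.
  have -> : C n = n.+1%:R * w (T n) by case: n mn.
  apply: (@le_trans _ _ (n.+1%:R * phi t)).
    by rewrite ler_wpM2r// ler_nat ltnS ltnW// ltnW.
  rewrite mulrC -ler_pdivlMr// mulrDl -mulrA -invfM -expr2 mulrAC mulfV ?pnatr_eq0// mul1r.
  have [Tn0 TnP] := TP n.
  have [Tt|tT] := leP (T n) t.
    by rewrite (le_trans (TnP _ Tt))// mulrC lerDl w0.
  rewrite (le_trans (T0P _ T0t))// mul1r (le_trans (wh _ _ t0 (ltW tT)))//.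
  by rewrite lerDr mulr_ge0 ?w0// ltW.
have sub (u : R -> R) : (forall t, `|u t| <= phi t) -> dominated u (envelope C \o w).
  move=> uphi; apply/dominatedP => c c0.
  have [S SP] := (dominatedP _ _).1 phiF _ c0.
  exists S => t /SP; apply: le_trans; rewrite (le_trans (uphi t))// ger0_norm//.
exists (envelope C \o w); split.
- by apply: weight_envelope => //; apply: sub => t; rewrite /phi lerDr.
- apply/dominatedP => c c0.
  have [n nc] : exists n : nat, 2 / c <= n.+1%:R.
    by exists (Num.truncn (2 / c)); apply/ltW/truncnS_gt.
  have [S SP] := weight_unbounded ww (2 * C n / c).
  exists (Num.max S 0) => t; rewrite ge_max => /andP[St t0] /=.
  rewrite (ger0_norm (envw _ t0)) (ger0_norm (w0 _ t0)).
  apply: le_trans (envelope_le Cge0 n _) _.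
  have h1 : w t / n.+1%:R <= c / 2 * w t.
    rewrite mulrC ler_wpM2r ?w0// -[c / 2]invrK invf_div lef_pV2 ?posrE ?ltr0n//.
    by rewrite divr_gt0.
  have h3 : C n <= c / 2 * w t.
    by have := SP _ St; rewrite ler_pdivrMr// => h2; lra.
  by rewrite [in leRHS](splitr c) mulrDl; exact: lerD.
- by apply: sub => t; rewrite /phi lerDl.
Qed.

(** The function w t / (N t + 1), with N t the least n such that t <= r n, is
    negligible with respect to w, since N t tends to infinity once
    the radii r n do (they are first replaced by larger ones); any weight
    between the two will do. *)
Lemma exists_weight_steps w (r : nat -> R) : weight w ->
  exists w1, [/\ weight w1, dominated w1 w &
    exists2 T : R, 0 <= T & forall n t, T <= t -> t <= r n -> 3 * (w t / n.+1%:R) <= w1 t].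
Proof.
move=> ww; have [[w0 wh _ _] _] := ww.
(* Enlarging the radii makes them unbounded, so that N is defined. *)
pose r' n := Num.max (r n) n%:R.
have ex (t : R) : exists n, t <= r' n.
  by exists (Num.truncn t).+1; rewrite le_max (ltW (truncnS_gt t)) orbT.
pose N t := ex_minn (ex t).
have Nle n t : t <= r' n -> (N t <= n)%N.
  by rewrite /N; case: ex_minnP => m _ h; exact: h.
have [w1 [ww1 w1w psiw1]] : exists w1, [/\ weight w1, dominated w1 w &
    dominated (fun t => w t / (N t).+1%:R) w1].
  apply: exists_weight_between => //; apply/dominatedP => c c0.
  have [m mc] : exists m : nat, c^-1 <= m.+1%:R.
    by exists (Num.truncn c^-1); apply/ltW/truncnS_gt.
  exists (1 + \sum_(n < m) `|r' n|) => t rt.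
  have t0 : 0 <= t by rewrite (le_trans _ rt)// addr_ge0// sumr_ge0.
  have mN : (m <= N t)%N.
    rewrite leqNgt; apply/negP => Nm.
    have : t <= r' (N t) by rewrite /N; case: ex_minnP.
    rewrite leNgt => /negP; apply; rewrite (lt_le_trans _ rt)//.
    rewrite (bigD1 (Ordinal Nm))//= (le_lt_trans (ler_norm _))//.
    by rewrite addrCA ltrDl ltr_pwDl// sumr_ge0.
  rewrite !ger0_norm ?w0 ?divr_ge0 ?w0// mulrC ler_wpM2r ?w0//.
  rewrite -[leRHS]invrK lef_pV2 ?posrE ?invr_gt0 ?ltr0n//.
  by rewrite (le_trans mc)// ler_nat ltnS.
exists w1; split => //.
have c3 : 0 < 3^-1 :> R by rewrite invr_gt0.
have [T TP] := (dominatedP _ _).1 psiw1 _ c3.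
exists (Num.max T 0); first by rewrite le_max lexx orbT.
move=> n t; rewrite ge_max => /andP[Tt t0] trn.
have [[w10 _ _ _] _] := ww1.
have := TP _ Tt; rewrite !ger0_norm ?w10 ?divr_ge0 ?w0// ler_pdivlMl//; apply: le_trans.
rewrite ler_wpM2l// ler_wpM2l ?w0// lef_pV2 ?posrE ?ltr0n// ler_nat ltnS.
by apply: Nle; rewrite le_max trn.
Qed.

End weights.

(** * Norms and cut-offs *)

Section weighted_norms.
Variables (R : realType) (d : nat).
Local Notation T := (d.-tuple (measurableTypeR R)).
Local Notation leb := (lebesgue_tuple R d).
Implicit Types (x y xi : 'rV[R]_d) (f chi g : 'rV[R]_d -> R[i]) (w s : R -> R)
  (Omega K : set 'rV[R]_d).

Lemma dot_ge0 x : 0 <= dot x x.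
Proof. by apply: sumr_ge0 => i _; rewrite -expr2 sqr_ge0. Qed.

Lemma enorm_ge0 x : 0 <= enorm x.
Proof. exact: sqrtr_ge0. Qed.

Lemma sqr_enorm x : enorm x ^+ 2 = dot x x.
Proof. by rewrite sqr_sqrtr// dot_ge0. Qed.

(** Cauchy-Schwarz, from the nonnegativity of the square of the vector
    enorm y *: x - enorm x *: y. *)
Lemma dot_le_enorm x y : dot x y <= enorm x * enorm y.
Proof.
have [x0|xn0] := eqVneq (enorm x) 0.
  have xi0 i : x 0 i = 0.
    have := sqr_enorm x; rewrite x0 expr0n/= => /esym/eqP.
    rewrite psumr_eq0 => [/allP/(_ i (mem_index_enum _))|j _]; last by rewrite -expr2 sqr_ge0.
    by rewrite /= mulf_eq0 orbb => /eqP.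
  by rewrite x0 mul0r /dot big1// => i _; rewrite xi0 mul0r.
have [y0|yn0] := eqVneq (enorm y) 0.
  have yi0 i : y 0 i = 0.
    have := sqr_enorm y; rewrite y0 expr0n/= => /esym/eqP.
    rewrite psumr_eq0 => [/allP/(_ i (mem_index_enum _))|j _]; last by rewrite -expr2 sqr_ge0.
    by rewrite /= mulf_eq0 orbb => /eqP.
  by rewrite y0 mulr0 /dot big1// => i _; rewrite yi0 mulr0.
have xp : 0 < enorm x by rewrite lt_neqAle eq_sym xn0 enorm_ge0.
have yp : 0 < enorm y by rewrite lt_neqAle eq_sym yn0 enorm_ge0.
have := dot_ge0 (enorm y *: x - enorm x *: y).
rewrite dotDl !dotDr !dotNr !dotNl !dotZl !dotZr -!sqr_enorm (dotC y x).
set a := enorm x; set b := enorm y => h.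
(* h is twice this inequality. *)
have {h} : 0 <= (a * b) * (a * b - dot x y).
  by move: h; lra.
by rewrite pmulr_rge0 ?mulr_gt0// subr_ge0.
Qed.

Lemma enormD x y : enorm (x + y) <= enorm x + enorm y.
Proof.
rewrite -[leRHS]ger0_norm ?addr_ge0 ?enorm_ge0// -sqrtr_sqr ler_wsqrtr//.
rewrite sqrrD !sqr_enorm dotDl !dotDr (dotC y x).
have := dot_le_enorm x y; lra.
Qed.

Lemma measurable_enorm : measurable_fun setT (fun t : T => enorm (vec t)).
Proof.
apply: (measurableT_comp (f := @Num.sqrt R)).
  by apply: continuous_measurable_fun; exact: sqrt_continuous.
apply: (@measurable_dot _ _ _ _ (fun t : T => vec t) (fun t => vec t)) => i;
  exact: (measurable_vec_coord i (@measurable_id _ _ _)).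
Qed.

Lemma measurable_weight_enorm w (l : R) : weight w ->
  measurable_fun setT (fun t : T => expR (l * w (enorm (vec t)))).
Proof.
move=> ww; apply: measurableT_comp => //; apply: measurable_funM => //.
have mw := measurable_weight ww.
have sub : (fun t : T => enorm (vec t)) @` setT `<=` [set` `[0%R, +oo[].
  by move=> _ [t _ <-]; rewrite /= in_itv/= andbT; exact: enorm_ge0.
exact: (measurable_comp (measurable_itv _) sub mw measurable_enorm).
Qed.

Lemma measurable_wnorm w (l : R) f : weight w -> compactly_supported f ->
  measurable_fun setT (fun t : T =>
    (normc (fourier f (vec t)) * expR (l * w (enorm (vec t))))%:E).
Proof.
move=> ww cf; apply/measurable_EFinP; apply: measurable_funM.
  exact: measurable_normc (cmeasurable_fourier cf).
exact: measurable_weight_enorm.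
Qed.

Lemma wnorm_ge0 w (l : R) f : (0 <= wnorm w l f)%E.
Proof.
by apply: integral_ge0 => t _; rewrite lee_fin mulr_ge0 ?expR_ge0// normc_ge0.
Qed.

Lemma wnorm_le w1 w2 (l1 l2 C : R) f : weight w1 -> weight w2 ->
  compactly_supported f ->
  (forall t, 0 <= t -> l1 * w1 t <= l2 * w2 t + C) ->
  (wnorm w1 l1 f <= (expR C)%:E * wnorm w2 l2 f)%E.
Proof.
move=> ww1 ww2 cf h; rewrite /wnorm /eint -ge0_integralZl//; last 2 first.
- exact: measurable_wnorm.
- by move=> t _; rewrite lee_fin mulr_ge0 ?expR_ge0// normc_ge0.
apply: ge0_le_integral => //.
- by move=> t _; rewrite lee_fin mulr_ge0 ?expR_ge0// normc_ge0.
- exact: measurable_wnorm.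
- by apply: measurable_funeM; exact: measurable_wnorm.
- move=> t _; rewrite -EFinM lee_fin mulrCA ler_wpM2l ?normc_ge0//.
  by rewrite -expRD ler_expR addrC h// enorm_ge0.
Qed.

Lemma spaceD_compactly_supported w Omega f :
  spaceD w Omega f -> compactly_supported f.
Proof. by move=> []. Qed.

Lemma spaceD_cintegrable w Omega f : weight w -> spaceD w Omega f ->
  cintegrable leb (fun t => fourier f (vec t)).
Proof.
move=> ww Df; have cf := spaceD_compactly_supported Df.
have [_ _ _ [l l0 foo]] := Df; have [[w0 _ _ _] _] := ww.
apply: cintegrable_lty; first exact: cmeasurable_fourier.
apply: le_lt_trans foo; apply: ge0_le_integral => //.
- by move=> t _; rewrite lee_fin normc_ge0.
- apply/measurable_EFinP; exact: measurable_normc (cmeasurable_fourier cf).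
- exact: measurable_wnorm.
- move=> t _; rewrite lee_fin ler_peMr ?normc_ge0//.
  by rewrite -expR0 ler_expR mulr_ge0 ?(ltW l0)// w0// enorm_ge0.
Qed.

Lemma wnorm_mul w w1 Omega chi f : weight w -> weight w1 -> spaceD w Omega chi ->
  compactly_supported f ->
  (wnorm w1 1%R (chi \* f)%R <=
    (2 / (2 * pi) ^+ d)%:E * (wnorm w1 1%R chi * wnorm w1 1%R f))%E.
Proof.
move=> ww ww1 Dchi cf; have [[w10 w1h _ _] [w1D _ _]] := ww1.
apply: (wnorm_mul_le (W := fun xi => expR (1 * w1 (enorm xi)))) => //.
- exact: measurable_weight_enorm.
- move=> x y; rewrite -expRD ler_expR !mul1r.
  rewrite (le_trans (w1h _ _ (enorm_ge0 _) (enormD x y)))//.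
  by apply: w1D; exact: enorm_ge0.
- exact: spaceD_compactly_supported Dchi.
- exact: spaceD_cintegrable Dchi.
Qed.

Lemma wnorm_dominated_lty w w1 Omega chi : weight w -> weight w1 -> dominated w1 w ->
  spaceD w Omega chi -> (wnorm w1 1%R chi < +oo)%E.
Proof.
move=> ww ww1 w1w Dchi; have cf := spaceD_compactly_supported Dchi.
have [_ _ _ [l l0 foo]] := Dchi.
have [C CP] := dominated_le ww1 ww w1w l0.
have h t : 0 <= t -> 1 * w1 t <= l * w t + C by move=> t0; rewrite mul1r CP.
apply: le_lt_trans (wnorm_le ww1 ww cf h) _.
by rewrite lte_mul_pinfty// lee_fin expR_ge0.
Qed.

(** Monotone convergence along the balls of integer radius; it applies also
    to infinite norms. *)
Lemma wnorm_truncate w (l a : R) f : weight w -> compactly_supported f ->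
  (a%:E < wnorm w l f)%E ->
  exists r : R, (a%:E < \int[leb]_(t in [set t : T | (enorm (vec t) <= r)%R])
    (normc (fourier f (vec t)) * expR (l * w (enorm (vec t))))%:E)%E.
Proof.
move=> ww cf af; apply: contrapT => /forallNP na.
pose F (n : nat) : set T := [set t | enorm (vec t) <= n%:R].
have mF n : measurable (F n).
  rewrite -[F n]setTI (_ : F n = (fun t : T => enorm (vec t)) @^-1` `]-oo, n%:R]).
    exact: measurable_enorm.
  by apply/seteqP; split => t; rewrite /F/= in_itv.
have UF : \bigcup_n F n = setT.
  apply/seteqP; split => // t _; exists (Num.truncn (enorm (vec t))).+1 => //.
  exact/ltW/truncnS_gt.
have mW := measurable_wnorm l ww cf.
have W0 t : (0 <= (normc (fourier f (vec t)) * expR (l * w (enorm (vec t))))%:E)%E.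
  by rewrite lee_fin mulr_ge0 ?expR_ge0// normc_ge0.
have ndF : nondecreasing_seq F.
  move=> m n mn; apply/subsetPset => t /le_trans; apply.
  by rewrite ler_nat.
have cv := @ge0_nondecreasing_set_cvg_integral _ T R F _ leb ndF mF
  (fun i => measurable_funTS mW) (fun i t _ => W0 t).
have : (wnorm w l f <= a%:E)%E.
  rewrite /wnorm /eint -UF -(cvg_lim _ cv)//.
  apply: lime_le; first by apply/cvg_ex; eexists; exact: cv.
  by near=> n; rewrite leNgt; apply/negP; exact: na.
by rewrite leNgt af.
Unshelve. all: by end_near. Qed.

Lemma wnormK_le_cutoff w Omega s K (l : R) chi g : spaceD w Omega chi ->
  (forall x, K x -> chi x = 1) -> (wnormK w Omega s K l g <= wnorm s l (chi \* g)%R)%E.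
Proof. by move=> Dchi chi1; apply: ereal_inf_lbound; exists chi. Qed.

Lemma wnormK_ge0 w Omega s K (l : R) g : (0 <= wnormK w Omega s K l g)%E.
Proof. by apply: le_ereal_inf_tmp => _ [psi _ <-]; exact: wnorm_ge0. Qed.

Lemma wnormK_le w Omega s1 s2 K (l1 l2 M : R) g : 0 < M -> spaceE w Omega g ->
  (forall f, compactly_supported f -> (wnorm s1 l1 f <= M%:E * wnorm s2 l2 f)%E) ->
  (wnormK w Omega s1 K l1 g <= M%:E * wnormK w Omega s2 K l2 g)%E.
Proof.
move=> M0 [_ Eg] h; rewrite -lee_pdivrMl//.
apply: le_ereal_inf_tmp => _ [psi [Dpsi psi1] <-].
rewrite lee_pdivrMl//; apply: le_trans (h _ _).
  exact: wnormK_le_cutoff.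
exact: spaceD_compactly_supported (Eg _ Dpsi).
Qed.

(** A cut-off psi equal to 1 on the support of chi satisfies
    chi * g = chi * (psi * g), so that submultiplicativity bounds the left-hand
    side uniformly in psi. *)
Lemma cutoff_wnorm_le w w1 Omega chi : weight w -> weight w1 -> dominated w1 w ->
  spaceD w Omega chi -> exists2 M : R, 0 < M & forall g, spaceE w Omega g ->
    (wnorm w1 1%R (chi \* g)%R <= M%:E * wnormK w Omega w1 (supp chi) 1%R g)%E.
Proof.
move=> ww ww1 w1w Dchi.
have chioo := wnorm_dominated_lty ww ww1 w1w Dchi.
have chifin : wnorm w1 1 chi \is a fin_num by rewrite ge0_fin_numE// wnorm_ge0.
pose k : R := 2 / (2 * pi) ^+ d.
have k0 : 0 < k by rewrite divr_gt0// exprn_gt0// mulr_gt0// pi_gt0.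
pose N := fine (wnorm w1 1 chi).
have N0 : 0 <= N by rewrite fine_ge0// wnorm_ge0.
exists (k * (N + 1)); first by rewrite mulr_gt0// ltr_wpDl.
have M0 : 0 < k * (N + 1) by rewrite mulr_gt0// ltr_wpDl.
move=> g [_ Eg]; rewrite -lee_pdivrMl//.
apply: le_ereal_inf_tmp => _ [psi [Dpsi psi1] <-].
rewrite lee_pdivrMl//.
have -> : chi \* g = chi \* (psi \* g).
  apply/funext => x /=; have [->|chix] := eqVneq (chi x) 0; first by rewrite !mul0r.
  by rewrite psi1 ?mul1r//; exact: subset_closure.
apply: le_trans (wnorm_mul ww ww1 Dchi (spaceD_compactly_supported (Eg _ Dpsi))) _.
rewrite -/k (EFinM k) -muleA lee_pmul2l// -(fineK chifin) -/N lee_wpmul2r ?wnorm_ge0//.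
by rewrite lee_fin lerDl.
Qed.

End weighted_norms.

(** * Comparison of the spaces of nets *)

Section nets.
Variables (R : realType) (d : nat).
Local Notation T := (d.-tuple (measurableTypeR R)).
Local Notation leb := (lebesgue_tuple R d).
Implicit Types (f chi : 'rV[R]_d -> R[i]) (w : R -> R)
  (g : R -> 'rV[R]_d -> R[i]) (Omega K : set 'rV[R]_d).

(** A single weight w1 << w detects the largeness of infinitely many
    w-norms whose orders 1 / (n + 1) tend to 0. The bounds b n are free;
    up to them w1 is also large pointwise. *)
Lemma wnorm_steps w (f : nat -> 'rV[R]_d -> R[i]) (a b : nat -> R) : weight w ->
  (forall n, compactly_supported (f n)) ->
  (forall n, (a n)%:E < wnorm w n.+1%:R^-1 (f n))%E ->
  exists w1, [/\ weight w1, dominated w1 w,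
    (exists2 c : R, 0 < c & forall n, ((c * a n)%:E <= wnorm w1 1%R (f n))%E) &
    (exists S : R, forall n t, S <= t -> t <= b n -> 3 * (w t / n.+1%:R) <= w1 t)].
Proof.
move=> ww cf af; have [[w0 wh _ _] _] := ww.
have [r rP] := choice (fun n => wnorm_truncate ww (cf n) (af n)).
have [w1 [ww1 w1w [S S0 SP]]] := exists_weight_steps (fun n => Num.max (r n) (b n)) ww.
have [[w10 _ _ _] _] := ww1.
exists w1; split => //; last first.
  by exists S => n t St tb; apply: SP => //; rewrite le_max tb orbT.
exists (expR (- w S)); first exact: expR_gt0.
move=> n; pose E : set T := [set t | enorm (vec t) <= r n].
have mE : measurable E.
  rewrite -[E]setTI (_ : E = (fun t : T => enorm (vec t)) @^-1` `]-oo, r n]).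
    exact: measurable_enorm.
  by apply/seteqP; split => t; rewrite /E/= in_itv.
have mW v (l : R) : weight v -> measurable_fun E (fun t : T =>
    (normc (fourier (f n) (vec t)) * expR (l * v (enorm (vec t))))%:E).
  by move=> wv; apply: measurable_funTS; exact: measurable_wnorm.
have W0 v (l : R) t : (0 <= (normc (fourier (f n) (vec t)) * expR (l * v (enorm (vec t))))%:E)%E.
  by rewrite lee_fin mulr_ge0 ?expR_ge0// normc_ge0.
apply: (@le_trans _ _ (\int[leb]_(t in E)
    (normc (fourier (f n) (vec t)) * expR (1 * w1 (enorm (vec t))))%:E)%E); last first.
  by apply: ge0_subset_integral => //; exact: measurable_wnorm.
apply: (@le_trans _ _ (\int[leb]_(t in E) ((expR (- w S))%:E *
    (normc (fourier (f n) (vec t)) * expR (n.+1%:R^-1 * w (enorm (vec t))))%:E))%E).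
  rewrite ge0_integralZl//; last exact: mW.
    by rewrite EFinM lee_pmul2l// ?lte_fin ?expR_gt0// ltW// rP.
apply: ge0_le_integral => //.
- by move=> t _; rewrite mule_ge0// lee_fin expR_ge0.
- by apply: measurable_funeM; exact: mW.
- exact: mW.
- move=> t Et; rewrite -EFinM lee_fin mulrCA ler_wpM2l ?normc_ge0//.
  rewrite -expRD ler_expR mul1r addrC lerBlDr.
  have t0 := enorm_ge0 (vec t).
  have [St|/ltW tS] := leP S (enorm (vec t)).
    have := SP n _ St; rewrite le_max Et => /(_ isT).
    have := w0 _ t0; have := w0 _ S0.
    have : 0 <= w (enorm (vec t)) / n.+1%:R by rewrite divr_ge0// w0.
    rewrite [n.+1%:R^-1 * _]mulrC; move: (_ / _) => v v0 wS _ vw1; lra.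
  apply: (@le_trans _ _ (w S)); last by rewrite lerDr w10.
  apply: le_trans (wh _ _ t0 tS).
  by rewrite ler_piMl ?w0// invf_le1// ler1n.
Qed.

(** Passing from q n to a smaller exponent p n absorbs the constant in the
    failing little-o, provided that eps n is small enough. *)
Lemma not_littleo_seq w Omega K chi g (p q : nat -> R) : weight w ->
  spaceD w Omega chi -> (forall x, K x -> chi x = 1) ->
  (forall n, p n < q n) ->
  (forall n, ~ ereal_littleo0 (fun e => wnormK w Omega w K n.+1%:R^-1 (g e))
                              (fun e => expR (q n * w e^-1))) ->
  exists eps : nat -> R, forall n, 0 < eps n < n.+2%:R^-1 /\
    ((expR (p n * w (eps n)^-1))%:E < wnorm w n.+1%:R^-1 (chi \* g (eps n))%R)%E.
Proof.
move=> ww Dchi chi1 pq H.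
suff /choice[eps epsP] : forall n : nat, exists e : R, 0 < e < n.+2%:R^-1 /\
    ((expR (p n * w e^-1))%:E < wnorm w n.+1%:R^-1 (chi \* g e)%R)%E by exists eps.
move=> n.
have [c /not_implyP[c0 nc]] := (existsNP _).2 (H n).
have [S SP] := weight_unbounded ww (- ln c / (q n - p n)).
pose S' := Num.max S 1.
have S'0 : 0 < S' by rewrite lt_max ltr01 orbT.
pose dl : R := Num.min n.+2%:R^-1 S'^-1.
have dl0 : 0 < dl by rewrite lt_min !invr_gt0 ltr0n S'0.
have [e [/andP[e0 edl] /negP]] : exists e, 0 < e < dl /\
    ~ (wnormK w Omega w K n.+1%:R^-1 (g e) <= (c * expR (q n * w e^-1))%:E)%E.
  apply: contrapT => /forallNP nex; apply: nc; apply/near_0rightP.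
  exists dl => // e edl; apply: contrapT => ne; exact: (nex e).
rewrite -ltNge => lt1; exists e; move: edl; rewrite lt_min => /andP[e1 e2].
rewrite e0 e1; split => //.
apply: lt_le_trans (wnormK_le_cutoff _ _ _ Dchi chi1).
apply: le_lt_trans lt1; rewrite lee_fin -[in leRHS](lnK c0) -expRD ler_expR.
have : S <= e^-1.
  rewrite (@le_trans _ _ S') ?le_max ?lexx// -[S']invrK lef_pV2 ?posrE ?invr_gt0//.
  exact: ltW.
move=> /SP; rewrite ler_pdivrMr ?subr_gt0//; lra.
Qed.

Lemma extract_weight w Omega K chi g (p q : nat -> R) : weight w -> netE w Omega g ->
  spaceD w Omega chi -> (forall x, K x -> chi x = 1) ->
  (forall n, p n < q n) ->
  (forall n, ~ ereal_littleo0 (fun e => wnormK w Omega w K n.+1%:R^-1 (g e))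
                              (fun e => expR (q n * w e^-1))) ->
  exists w1 (eps : nat -> R) (c S : R), [/\ weight w1, dominated w1 w, 0 < c,
    (forall n, 0 < eps n < n.+2%:R^-1 /\
      ((c * expR (p n * w (eps n)^-1))%:E <=
        wnormK w Omega w1 (supp chi) 1%R (g (eps n)))%E) &
    forall n, S <= (eps n)^-1 -> 3 * (w (eps n)^-1 / n.+1%:R) <= w1 (eps n)^-1].
Proof.
move=> ww Eg Dchi chi1 pq H.
have [eps epsP] := not_littleo_seq ww Dchi chi1 pq H.
have eps1 n : 0 < eps n < 1.
  have [/andP[-> e1] _] := epsP n.
  by rewrite (lt_le_trans e1)// invf_le1// ler1n.
have cf n : compactly_supported (chi \* g (eps n)).
  by apply: spaceD_compactly_supported; exact: (Eg _ (eps1 n)).2.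
have [w1 [ww1 w1w [c c0 cP] [S SP]]] :=
  wnorm_steps (fun n => (eps n)^-1) ww cf (fun n => (epsP n).2).
have [M M0 MP] := cutoff_wnorm_le ww ww1 w1w Dchi.
exists w1, eps, (M^-1 * c), S; split => //.
- by rewrite mulr_gt0// invr_gt0.
- move=> n; split; first exact: (epsP n).1.
  rewrite -mulrA EFinM lee_pdivrMl//.
  exact: le_trans (cP n) (MP _ (Eg _ (eps1 n))).
- by move=> n Sn; apply: SP.
Qed.

(** The infimum over an empty set of cut-offs is +oo, which no real bound
    dominates. *)
Lemma no_cutoff_littleo0 w Omega s K (l : R) g (G : R -> R) :
  ~ (exists2 chi, spaceD w Omega chi & forall x, K x -> chi x = 1) ->
  ~ ereal_littleo0 (fun e => wnormK w Omega s K l (g e)) G.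
Proof.
move=> nchi /(_ 1 ltr01)/near_0rightP[dl dl0 h].
have := h (dl / 2); rewrite divr_gt0// ltr_pdivrMr// ltr_pMr// ltr1n => /(_ isT).
have nocut : [set psi | spaceD w Omega psi /\ forall x, K x -> psi x = 1] = set0.
  by apply/seteqP; split => // chi [Dchi chi1]; apply: nchi; exists chi.
by rewrite /wnormK nocut image_set0 ereal_inf0.
Qed.

Lemma exists_weight_below w : weight w -> exists w1, weight w1 /\ dominated w1 w.
Proof.
move=> ww; have [|w1 [ww1 w1w _]] := @exists_weight_between R w (fun=> 0) ww.
  by apply/dominatedP => c c0; exists 0 => t _; rewrite normr0 mulr_ge0// ltW.
by exists w1.
Qed.

(** The positive part psi of the logarithm of the norm, as a function of 1 / e,
    is negligible with respect to w by moderateness; a weight w2 with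
    psi << w2 << w absorbs it. *)
Lemma moderate_sub_tilde w Omega g : weight w ->
  moderate_nets w Omega g -> moderate_nets_tilde w Omega g.
Proof.
move=> ww [Eg gP]; split=> // w1 ww1 w1w K cK.
pose X (t : R) := wnormK w Omega w1 K 1 (g t^-1).
have X0 t : (0 <= X t)%E by exact: wnormK_ge0.
have Xk k : 0 < k -> exists S : R, forall t, S <= t -> (X t <= (expR (k * w t))%:E)%E.
  move=> k0; have [h h0 ho] := gP _ cK _ k0.
  have [C CP] := dominated_le ww1 ww w1w h0.
  have eC0 : 0 < expR C by exact: expR_gt0.
  have eCV0 : 0 < (expR C)^-1 by rewrite invr_gt0.
  have /near_0rightP[dl dl0 dlP] := ho _ eCV0.
  exists (Num.max 2 (2 / dl)) => t; rewrite ge_max => /andP[t2 tdl].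
  have t0 : 0 < t by rewrite (lt_le_trans _ t2).
  have tV : 0 < t^-1 < 1 by rewrite invr_gt0 t0/= invf_lt1// (lt_le_trans _ t2)// ltr1n.
  have tdl' : 0 < t^-1 < dl.
    rewrite invr_gt0 t0/= -[dl]invrK ltf_pV2 ?posrE ?invr_gt0//.
    by rewrite (lt_le_trans _ tdl)// ltr_pMl ?invr_gt0// ltr1n.
  have := dlP _ tdl'; rewrite invrK => h1.
  apply: (@le_trans _ _ ((expR C)%:E * wnormK w Omega w K h (g t^-1%R))%E).
    apply: wnormK_le; [exact: eC0|exact: Eg|].
    by move=> f cf; apply: wnorm_le => // u u0; rewrite mul1r CP.
  by rewrite -lee_pdivlMl// -EFinM.
pose psi t : R := Num.max 0 (ln (fine (X t))).
have psiw : dominated psi w.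
  apply/dominatedP => k k0; have [S SP] := Xk _ k0.
  exists (Num.max S 0) => t; rewrite ge_max => /andP[St t0].
  have [[w0 _ _ _] _] := ww.
  have kw0 : 0 <= k * w t by rewrite mulr_ge0 ?w0// ltW.
  rewrite (ger0_norm (w0 _ t0)) ger0_norm ?le_max ?lexx// ge_max kw0/=.
  have [X1|X1] := leP (fine (X t)) 0; first by rewrite ln0.
  rewrite -[leRHS]expRK ler_ln ?posrE ?expR_gt0// -lee_fin fineK ?SP//.
  by rewrite ge0_fin_numE// (le_lt_trans (SP _ St))// ltry.
have [w2 [ww2 w2w psiw2]] := exists_weight_between ww psiw.
exists w2; split => // c c0.
have [[w20 _ _ _] _] := ww2.
have h0 : 0 < 2^-1 :> R by rewrite invr_gt0.
have [S1 S1P] := (dominatedP _ _).1 psiw2 _ h0.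
have [S2 S2P] := Xk 1 ltr01.
have [S3 S3P] := weight_unbounded ww2 (- (2 * ln c)).
pose S := Num.max (Num.max S1 S2) (Num.max S3 1).
have S0 : 0 < S by rewrite !lt_max ltr01 !orbT.
apply/near_0rightP; exists S^-1; first by rewrite invr_gt0.
move=> e /andP[e0 eS].
have : S <= e^-1 by rewrite -[S]invrK lef_pV2 ?posrE ?invr_gt0// ltW.
rewrite !ge_max => /andP[/andP[s1 s2] /andP[s3 _]].
have Xfin : X e^-1 \is a fin_num.
  by rewrite ge0_fin_numE// (le_lt_trans (S2P _ s2))// ltry.
rewrite -[e in g e]invrK -/(X e^-1) -(fineK Xfin) lee_fin.
apply: (@le_trans _ _ (expR (psi e^-1))).
  have [X1|X1] := leP (fine (X e^-1)) 0; first by rewrite (le_trans X1)// expR_ge0.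
  by rewrite -{1}(lnK X1) ler_expR le_max lexx orbT.
rewrite -[in leRHS](lnK c0) -expRD ler_expR.
have := S1P _ s1; have := S3P _ s3.
rewrite [`|w2 _|]ger0_norm ?w20 ?invr_ge0 ?(ltW e0)//.
have := ler_norm (psi e^-1); lra.
Qed.

Lemma eps_small (eps : nat -> R) (A : R) : (forall n, 0 < eps n < n.+2%:R^-1) ->
  exists n, A <= (eps n)^-1.
Proof.
move=> epsP; exists (Num.truncn A); have /andP[e0 e1] := epsP (Num.truncn A).
apply: (@le_trans _ _ (Num.truncn A).+2%:R).
  by rewrite (le_trans (ltW (truncnS_gt A)))// ler_nat.
by rewrite -[leLHS]invrK lef_pV2 ?posrE ?invr_gt0// ltW.
Qed.

(** Moderateness fails for some k at all orders 1 / (n + 1): the extracted w1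
    has norms at least c * expR (k / 2 * w (1 / e)) along a sequence, whereas
    w2 << w allows at most expR (k / 4 * w (1 / e)). *)
Lemma tilde_sub_moderate w Omega g : weight w ->
  (forall K, compact_in Omega K ->
     exists2 chi, spaceD w Omega chi & forall x, K x -> chi x = 1) ->
  moderate_nets_tilde w Omega g -> moderate_nets w Omega g.
Proof.
move=> ww cut [Eg gP]; split=> // K cK k k0.
apply: contrapT => nex.
have H n : ~ ereal_littleo0 (fun e => wnormK w Omega w K n.+1%:R^-1 (g e))
                            (fun e => expR (k * w e^-1)).
  by move=> h; apply: nex; exists n.+1%:R^-1 => //; rewrite invr_gt0.
have [chi Dchi chi1] := cut _ cK.
have pq (n : nat) : k / 2 < k by rewrite ltr_pdivrMr// ltr_pMr// ltr1n.
have [w1 [eps [c [S [ww1 w1w c0 epsP _]]]]] := extract_weight ww Eg Dchi chi1 pq H.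
have csupp : compact_in Omega (supp chi) by have [_ ? ? _] := Dchi.
have [w2 [ww2 w2w /(_ 1 ltr01)/near_0rightP[dl dl0 dlP]]] := gP _ ww1 w1w _ csupp.
have k4 : 0 < k / 4 by rewrite divr_gt0.
have [S1 S1P] := (dominatedP _ _).1 w2w _ k4.
have [S2 S2P] := weight_unbounded ww ((1 - ln c) / (k / 4)).
have [n] := eps_small (Num.max (Num.max S1 S2) (2 / dl)) (fun n => (epsP n).1).
rewrite !ge_max => /andP[/andP[s1 s2] s3].
have [/andP[e0 _] le1] := epsP n.
have edl : 0 < eps n < dl.
  rewrite e0/= -[eps n]invrK -[dl]invrK ltf_pV2 ?posrE ?invr_gt0//.
  by rewrite (lt_le_trans _ s3)// ltr_pMl ?invr_gt0// ltr1n.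
have := le_trans le1 (dlP _ edl).
rewrite mul1r lee_fin -{1}(lnK c0) -expRD ler_expR.
have [[w0 _ _ _] _] := ww; have [[w20 _ _ _] _] := ww2.
have := S1P _ s1; rewrite !ger0_norm ?w0 ?w20 ?invr_ge0 ?(ltW e0)//.
have := S2P _ s2; rewrite ler_pdivrMr//; clear pq; lra.
Qed.

Lemma negligible_sub_tilde w Omega g : weight w ->
  negligible_nets w Omega g -> negligible_nets_tilde w Omega g.
Proof.
move=> ww [Eg gP]; split=> // K cK w1 ww1 w1w w2 ww2 w2w c c0.
have [k k0 [h h0 ho]] := gP _ cK.
have [C CP] := dominated_le ww1 ww w1w h0.
have eC0 : 0 < expR C by exact: expR_gt0.
have c'0 : 0 < (expR C)^-1 * c by rewrite mulr_gt0// invr_gt0.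
have /near_0rightP[dl dl0 dlP] := ho _ c'0.
have [S SP] := (dominatedP _ _).1 w2w _ k0.
pose S' := Num.max S 2.
have S'0 : 0 < S' by rewrite lt_max ltr0n orbT.
apply/near_0rightP; exists (Num.min dl S'^-1); first by rewrite lt_min dl0 invr_gt0.
move=> e; rewrite lt_min => /andP[e0 /andP[edl eS]].
have : S' <= e^-1 by rewrite -[S']invrK lef_pV2 ?posrE ?invr_gt0// ltW.
rewrite ge_max => /andP[Se e2].
have e1 : 0 < e < 1.
  by rewrite e0/= -[e]invrK invf_lt1 ?invr_gt0// (lt_le_trans _ e2)// ltr1n.
apply: (@le_trans _ _ ((expR C)%:E * wnormK w Omega w K h (g e))%E).
  apply: wnormK_le; [exact: eC0|exact: Eg|].
  by move=> f cf; apply: wnorm_le => // u u0; rewrite mul1r CP.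
rewrite -lee_pdivlMl// -EFinM.
have := dlP e; rewrite e0 edl => /(_ isT) h1; apply: le_trans h1 _.
rewrite lee_fin mulrA ler_wpM2l ?(ltW c'0)// ler_expR mulNr lerN2.
have [[w0 _ _ _] _] := ww; have [[w20 _ _ _] _] := ww2.
by have := SP _ Se; rewrite !ger0_norm ?w0 ?w20 ?invr_ge0 ?(ltW e0).
Qed.

(** The extracted w1 has norms at least c * expR (- (2 / (n + 1)) * w (1 / e))
    at e = eps n. Taking w1 for the second weight as well bounds
    them by c / 2 * expR (- w1 (1 / e)), where
    w1 (1 / e) >= 3 / (n + 1) * w (1 / e). *)
Lemma tilde_sub_negligible w Omega g : weight w ->
  (forall K, compact_in Omega K ->
     exists2 chi, spaceD w Omega chi & forall x, K x -> chi x = 1) ->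
  negligible_nets_tilde w Omega g -> negligible_nets w Omega g.
Proof.
move=> ww cut [Eg gP]; split=> // K cK.
apply: contrapT => nex.
have nS (n : nat) : 0 < n.+1%:R^-1 :> R by rewrite invr_gt0.
have H n : ~ ereal_littleo0 (fun e => wnormK w Omega w K n.+1%:R^-1 (g e))
                            (fun e => expR (- n.+1%:R^-1 * w e^-1)).
  by move=> h; apply: nex; exists n.+1%:R^-1 => //; exists n.+1%:R^-1.
have [chi Dchi chi1] := cut _ cK.
have pq (n : nat) : - (2 * n.+1%:R^-1) < - n.+1%:R^-1 :> R.
  by rewrite ltrN2 ltr_pMl// ltr1n.
have [w1 [eps [c [S [ww1 w1w c0 epsP SP]]]]] := extract_weight ww Eg Dchi chi1 pq H.
have csupp : compact_in Omega (supp chi) by have [_ ? ? _] := Dchi.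
have c20 : 0 < c / 2 by rewrite divr_gt0.
have /(_ _ c20)/near_0rightP[dl dl0 dlP] := gP _ csupp _ ww1 w1w _ ww1 w1w.
have [n] := eps_small (Num.max S (2 / dl)) (fun n => (epsP n).1).
rewrite !ge_max => /andP[s1 s3].
have [/andP[e0 _] le1] := epsP n.
have edl : 0 < eps n < dl.
  rewrite e0/= -[eps n]invrK -[dl]invrK ltf_pV2 ?posrE ?invr_gt0//.
  by rewrite (lt_le_trans _ s3)// ltr_pMl ?invr_gt0// ltr1n.
have := le_trans le1 (dlP _ edl); rewrite lee_fin => le2.
have [[w0 _ _ _] _] := ww.
have h3 := SP _ s1.
have wn : 0 <= w (eps n)^-1 / n.+1%:R by rewrite divr_ge0// w0// invr_ge0 ltW.
have : expR (- w1 (eps n)^-1) <= expR (- (2 * n.+1%:R^-1) * w (eps n)^-1).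
  rewrite ler_expR mulNr lerN2 -mulrA [_^-1 * _]mulrC.
  by rewrite (le_trans _ h3)// ler_wpM2r// ler_nat.
have := expR_gt0 (- (2 * n.+1%:R^-1) * w (eps n)^-1).
move: le2; set a := expR (- w1 _); set b := expR _ => le2 b0 ab.
have : c * b <= c / 2 * b by rewrite (le_trans le2)// ler_wpM2l// ltW.
rewrite ler_pM2r// => cc; clear pq; lra.
Qed.

End nets.

Unset Implicit Arguments.

Theorem proposition5p8 (R : realType) (d : nat) (Omega : set 'rV[R]_d)
    (w : R -> R) :
  open Omega -> weight w ->
  moderate_nets w Omega = moderate_nets_tilde w Omega /\
  negligible_nets w Omega = negligible_nets_tilde w Omega.
Proof.
move=> _ ww.
have [cut|] := pselect (forall K, compact_in Omega K ->
    exists2 chi, spaceD w Omega chi & forall x, K x -> chi x = 1).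
  split; apply/seteqP; split => g.
  - exact: moderate_sub_tilde.
  - exact: tilde_sub_moderate.
  - exact: negligible_sub_tilde.
  - exact: tilde_sub_negligible.
(* Some compact set has no cut-off: all four sets are empty. *)
move=> /existsNP[K /not_implyP[cK nchi]].
have [w1 [ww1 w1w]] := exists_weight_below ww.
split; apply/seteqP; split => g [_ gP].
- by have [h _ /(no_cutoff_littleo0 nchi)] := gP _ cK 1 ltr01.
- by have [w2 [_ _ /(no_cutoff_littleo0 nchi)]] := gP _ ww1 w1w _ cK.
- by have [k _ [h _ /(no_cutoff_littleo0 nchi)]] := gP _ cK.
- by have /(no_cutoff_littleo0 nchi) := gP _ cK _ ww1 w1w _ ww1 w1w.
Qed.
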